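(* There is an absolute constant $\gamma>0$ and a deterministic algorithm which, given a graph $G=(V,E)$ with $n$ vertices and an integer $1<m\le n$, computes within a relative error of $0.1$, in $n^{O(\ln m)}$ time, the sum $$\mathrm{Density}_m(G)=\sum_{\substack{S\subset V\\ |S|=m}} w(S),$$ where for an $m$-subset $S\subset V$ of density $\sigma(S)=t$ the weight is $$w(S)=e^{\gamma m}\left(1+\frac{\gamma}{m-1}\right)^{(t-1)\binom m2}\left(1-\frac{\gamma}{m-1}\right)^{(1-t)\binom m2},$$ and these weights satisfy $$w(S)=\exp\left\{\gamma m\,\sigma(S)+O\left(\frac1m\right)\right\}.$$ All implicit constants in the ''$O$'' notation are absolute. One can choose $\gamma=0.06$; and if $n\ge 4m$ and $m\ge 10$, one can choose $\gamma=0.18$.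
   Context: Graphs are undirected, without loops or multiple edges. For a subset $S\subset V$ of the vertex set of $G=(V,E)$ with $|S|\ge 2$, the density of $S$ is $$\sigma(S)=\frac{|\{\{u,v\}\in E:\ u,v\in S\}|}{\binom{|S|}{2}},$$ so $0\le\sigma(S)\le1$. Computing a positive quantity $Q$ within relative error $0.1$ means outputting a number $A$ with $|A-Q|\le 0.1\,Q$. Time is measured by the number of arithmetic operations. *)

(* Defs.v *)
From HB Require Import structures.
From mathcomp Require Import all_boot all_order all_algebra.
From mathcomp Require Import all_classical all_reals all_analysis.

Set Implicit Arguments.
Unset Strict Implicit.
Unset Printing Implicit Defensive.

Import Order.TTheory GRing.Theory Num.Theory.

Local Open Scope ring_scope.

Record sgraph (V : finType) := SGraph {
  edges : {set {set V}};
  edges_card2 : forall e, e \in edges -> #|e| = 2%N }.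

Section Density.
Variables (R : realType) (V : finType) (G : sgraph V).

Definition density (S : {set V}) : R :=
  #|[set e in edges G | e \subset S]|%:R / 'C(#|S|, 2)%:R.

Definition weight (gamma : R) (m : nat) (S : {set V}) : R :=
  let t := density S in
  expR (gamma * m%:R)
  * (1 + gamma / (m%:R - 1)) `^ ((t - 1) * 'C(m, 2)%:R)
  * (1 - gamma / (m%:R - 1)) `^ ((1 - t) * 'C(m, 2)%:R).

Definition Density (gamma : R) (m : nat) : R :=
  \sum_(S : {set V} | #|S| == m) weight gamma m S.

End Density.

(* The model of computation is a random access machine over the rationals: a
   fixed program works on finitely many named arrays of rationals, each
   unbounded, by means of arithmetic operations, comparisons, indirect
   addressing, branching and loops.  There is no rounding operation, and a
   program is stuck (so it has no run at all) when it divides by zero or uses as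
   an index a number that is not a natural number. *)

Inductive op := OpAdd | OpSub | OpMul | OpDiv | OpLt | OpEq.

Inductive expr :=
  | Cst of rat
  | Read of nat & expr  (* [Read x e]: the cell of index [e] of array [x] *)
  | Op of op & expr & expr.

Inductive prog :=
  | Skip
  | Write of nat & expr & expr  (* [Write x e1 e2] is x[e1] := e2 *)
  | Seq of prog & prog
  | If of expr & prog & prog
  | While of expr & prog.

Definition store := nat -> nat -> rat.

Definition update (s : store) (x k : nat) (v : rat) : store :=
  fun y l => if (y == x) && (l == k) then v else s y l.

Definition apply_op (o : op) (a b : rat) : rat :=
  match o with
  | OpAdd => a + b
  | OpSub => a - b
  | OpMul => a * b
  | OpDiv => a / b
  | OpLt => (a < b)%R%:R
  | OpEq => (a == b)%:R
  end.

Inductive eval (s : store) : expr -> rat -> Prop :=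
  | eval_cst q : eval s (Cst q) q
  | eval_read x e k : eval s e k%:R -> eval s (Read x e) (s x k)
  | eval_op o e1 e2 a b : eval s e1 a -> eval s e2 b ->
      (o = OpDiv -> b != 0) -> eval s (Op o e1 e2) (apply_op o a b).

Fixpoint cost (e : expr) : nat :=
  match e with
  | Cst _ => 1
  | Read _ e1 => (cost e1).+1
  | Op _ e1 e2 => (cost e1 + cost e2).+1
  end.

(* [exec s p t s']: started in [s], the program [p] halts in [s'] after [t]
   steps.  Memory accesses, constants and tests are charged as well, so [t]
   bounds the number of arithmetic operations from above. *)
Inductive exec : store -> prog -> nat -> store -> Prop :=
  | exec_skip s : exec s Skip 1 s
  | exec_write s x e1 e2 k v : eval s e1 k%:R -> eval s e2 v ->
      exec s (Write x e1 e2) (cost e1 + cost e2).+1 (update s x k v)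
  | exec_seq s s1 s2 p1 p2 t1 t2 :
      exec s p1 t1 s1 -> exec s1 p2 t2 s2 -> exec s (Seq p1 p2) (t1 + t2) s2
  | exec_if s s1 e v p1 p2 t :
      eval s e v -> exec s (if v != 0 then p1 else p2) t s1 ->
      exec s (If e p1 p2) (cost e + t).+1 s1
  | exec_while_end s e p : eval s e 0 -> exec s (While e p) (cost e).+1 s
  | exec_while_step s s1 s2 e v p t1 t2 :
      eval s e v -> v != 0 -> exec s p t1 s1 -> exec s1 (While e p) t2 s2 ->
      exec s (While e p) (cost e + t1 + t2).+1 s2.

Lemma eval_det s e a b : eval s e a -> eval s e b -> a = b.
Proof.
move=> H; elim: H b => {e a}.
- by move=> q b H; inversion H.
- move=> x e k _ IH b H.
  inversion H as [|x' e' k' Hk'|]; subst.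
  by have /eqP := IH _ Hk'; rewrite eqr_nat => /eqP ->.
- move=> o e1 e2 a1 a2 _ IH1 _ IH2 _ b H.
  inversion H as [| |o' e1' e2' b1 b2 Hb1 Hb2 _]; subst.
  by rewrite (IH1 _ Hb1) (IH2 _ Hb2).
Qed.

Lemma exec_det s p t1 s1 t2 s2 :
  exec s p t1 s1 -> exec s p t2 s2 -> t1 = t2 /\ s1 = s2.
Proof.
move=> H; elim: H t2 s2 => {s p t1 s1}.
- by move=> s t2 s2 H; inversion H.
- move=> s x e1 e2 k v Hk Hv t2 s2 H.
  inversion H as [|? ? ? ? k' v' Hk' Hv'| | | |]; subst.
  rewrite (eval_det Hv Hv'); have /eqP := eval_det Hk Hk'.
  by rewrite eqr_nat => /eqP ->.
- move=> s s1 s2 p1 p2 t1 t2 _ IH1 _ IH2 t s' H.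
  inversion H as [| |? s1' ? ? ? ? ? H1 H2| | |]; subst.
  have [-> E] := IH1 _ _ H1; rewrite -E in H2.
  by have [-> ->] := IH2 _ _ H2.
- move=> s s1 e v p1 p2 t Hv _ IH t' s' H.
  inversion H as [| | |? ? ? v' ? ? ? Hv' H1| |]; subst.
  rewrite -(eval_det Hv Hv') in H1.
  by have [-> ->] := IH _ _ H1.
- move=> s e p He t' s' H.
  inversion H as [| | | | |? ? ? ? v ? ? ? Hv nz _ _]; subst => //.
  by move: nz; rewrite (eval_det Hv He) eqxx.
- move=> s s1 s2 e v p t1 t2 Hv nz _ IH1 _ IH2 t' s' H.
  inversion H as [| | | |? ? ? Hv'|? ? ? ? v' ? ? ? Hv' _ H1 H2]; subst.
    by move: nz; rewrite (eval_det Hv Hv') eqxx.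
  have [-> E] := IH1 _ _ H1; rewrite -E in H2.
  by have [-> ->] := IH2 _ _ H2.
Qed.

(* Array 0 holds n = #|V| and m; array 1 holds the adjacency matrix, row by row,
   for the enumeration of V; all other cells are 0. *)
Definition input (V : finType) (G : sgraph V) (m : nat) : store :=
  fun x k =>
    match x, k with
    | 0, 0 => #|V|%:R
    | 0, 1 => m%:R
    | 1, _ => [exists u : V, exists v : V,
                 (k == enum_rank u * #|V| + enum_rank v)%N
                 && ([set u; v] \in edges G)]%:R
    | _, _ => 0
    end.

Definition output (s : store) : rat := s 2%N 0%N.

(* [dom n m] restricts the inputs on which the claims are made. *)
Definition density_algorithm (R : realType) (gamma : R)
    (dom : nat -> nat -> bool) (p : prog) (C : R) : Prop :=
  forall (V : finType) (G : sgraph V) (m : nat),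
    (1 < m <= #|V|)%N -> dom #|V| m ->
    exists (t : nat) (s : store),
      [/\ exec (input G m) p t s,
          t%:R <= #|V|%:R `^ (C * ln m%:R)
        & `| ratr (output s) - Density G gamma m | <= 1/10 * Density G gamma m].

Definition weight_estimate (R : realType) (gamma : R)
    (dom : nat -> nat -> bool) (C : R) : Prop :=
  forall (V : finType) (G : sgraph V) (m : nat) (S : {set V}),
    (1 < m <= #|V|)%N -> dom #|V| m -> #|S| = m ->
    exists2 delta : R, `| delta | <= C / m%:R
      & weight G gamma m S = expR (gamma * m%:R * density R G S + delta).

Definition density_claim (R : realType) (gamma : R)
    (dom : nat -> nat -> bool) : Prop :=
  (exists (p : prog) (C : R), density_algorithm gamma dom p C) /\
  (exists C : R, weight_estimate gamma dom C).

(* Main.v *)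
Require Import Defs.
From HB Require Import structures.
From mathcomp Require Import all_boot all_order all_algebra all_fingroup.
From mathcomp Require Import all_classical all_reals all_analysis.
From mathcomp Require Import complex.
From mathcomp Require Import fintype finset ring lra zify.
Import Defs.

(** Put g = gamma / (m - 1) and let p be the polynomial
    p(x) = sum over the m-sets S of the product over the pairs e in S of 1 + x a_e,
    where a_e = g if e is an edge and a_e = - g otherwise. The sum of the weights
    is exp(gamma m) (1 + g)^(- 'C(m, 2)) p(1) ([DensityE]), while p(0) = 'C(n, m).
    The coefficient of x^k in p is a sum over the sets of k pairs, so it can be
    computed in time n^O(k) ([coef_density_poly]).

    The heart of the matter is that p has no zero of modulus at most 19/18. Then
    the Taylor series of ln (p / p(0)) at 0 converges geometrically at 1, and
    O(ln m) terms approximate ln (p(1) / p(0)) to a small absolute error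
    ([log_taylor], [tail_bound]). Newton's recursion computes these terms from the
    coefficients of p of no larger degree. No complex logarithm is needed:
    p is factored over its roots, and ln |1 - q| is expanded for each inverse root
    q ([log_factor]).

    For the absence of zeros ([clique_sum_neq0]), let the weights z_e vary in a
    polydisc around 1 and let P_A be the sum over the m-sets S containing A. Since
    (m - |A|) P_A is the sum of P_(A + v) over the vertices v outside A, it suffices
    that these numbers are nonzero and lie in a narrow cone. The transposition of i
    and j turns P_(A + i) at z into P_(A + j) at z, so the angle between them is
    controlled by the logarithmic derivative of P_(A + i) along the segment from z
    to the transposed point ([turn_bound]). This derivative is a combination of sums
    P_B with larger B, only pairs at i or j contribute, and by the cone property for
    larger sets their total is at most an absolute constant ([spread_step]).
    Descending induction on |A| concludes. The constants 6/100 and 18/100 come from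
    the size of the cone; the second one uses that, for n >= 4 m, the sum P_(A + j)
    is at most a fixed fraction of P_A.

    The program lists all sets of at most K = O(ln m) pairs, with the vertices that
    they touch, sums up their terms to obtain the coefficients of p, runs the
    recursion for the coefficients of the logarithm, and outputs (1 + Y / M)^M in
    place of exp Y, for a large M, times the exact factors 'C(n, m) and
    (1 + g)^(- 'C(m, 2)) ([density_prog_ok], [density_algorithm_ok]). Its running
    time is polynomial in the largest loop count, which is n^O(ln m)
    ([budget_cost]).

    The estimate of the weights is the expansion ln ((1 - g) / (1 + g)) =
    - 2 g + O(g^3) ([weight_estimate_ok]). *)

Set Implicit Arguments.
Unset Strict Implicit.
Unset Printing Implicit Defensive.

Import Order.TTheory GRing.Theory Num.Theory.
Import numFieldNormedType.Exports.

Local Open Scope ring_scope.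

Local Notation Re := complex.Re.
Local Notation Im := complex.Im.

(** * Complex polynomials that turn slowly along a segment *)

Section Arc.
Variable R : realType.
Implicit Types (u v : {poly R}) (th t : R).

(** The only use of the mean value theorem: all derivative bounds below are
    integrated over the unit interval. *)
Lemma bounded_slope (f df : R -> R) (B : R) :
  (forall t, 0 <= t <= 1 -> is_derive t 1 f (df t)) ->
  (forall t, 0 <= t <= 1 -> df t <= B) -> f 1 - f 0 <= B.
Proof.
move=> fdf dfB.
have [c] : exists2 c, c \in `]0, 1[%R & f 1 - f 0 = df c * (1 - 0).
  apply: MVT => //.
    by move=> x; rewrite in_itv /= => /andP[x0 x1]; apply: fdf; rewrite !ltW.
  apply: derivable_within_continuous => x; rewrite in_itv /= => /fdf xd.
  exact: ex_derive.
by rewrite in_itv /= => /andP[c0 c1] ->; rewrite subr0 mulr1 dfB // !ltW.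
Qed.

(** The point (u, v) normalised to the unit circle moves with speed at most
    [th], and a chord is no longer than its arc, so its two end points are at
    distance at most [th]; that distance is sqrt (2 - 2 cos) of the angle. The
    chord gives the bound without any choice of an argument function. *)
Lemma arc_chord u v th : 0 <= th ->
  (forall t, 0 <= t <= 1 -> 0 < u.[t] ^+ 2 + v.[t] ^+ 2) ->
  (forall t, 0 <= t <= 1 ->
    u^`().[t] ^+ 2 + v^`().[t] ^+ 2 <= th ^+ 2 * (u.[t] ^+ 2 + v.[t] ^+ 2)) ->
  (1 - th ^+ 2 / 2)
    * (Num.sqrt (u.[0] ^+ 2 + v.[0] ^+ 2) * Num.sqrt (u.[1] ^+ 2 + v.[1] ^+ 2))
  <= u.[0] * u.[1] + v.[0] * v.[1].
Proof.
move=> th0 pos slope.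
pose S := u ^+ 2 + v ^+ 2.
have ES t : S.[t] = u.[t] ^+ 2 + v.[t] ^+ 2 by rewrite !hornerE.
have ES' t : S^`().[t] = 2 * (u.[t] * u^`().[t] + v.[t] * v^`().[t]).
  by rewrite /S derivD !expr2 !derivM !(hornerD, hornerM); ring.
pose q t := Num.sqrt S.[t].
have q_gt0 t : 0 <= t <= 1 -> 0 < q t by move=> t01; rewrite sqrtr_gt0 ES pos.
have qq t : 0 <= t <= 1 -> q t ^+ 2 = u.[t] ^+ 2 + v.[t] ^+ 2.
  by move=> t01; rewrite sqr_sqrtr ES // ltW // pos.
rewrite -!ES -/(q 0) -/(q 1).
have q0 := q_gt0 0 _; have q1 := q_gt0 1 _; rewrite !lexx !ler01 in q0 q1.
move/(_ isT): q0 => q0; move/(_ isT): q1 => q1.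
pose a := u.[1] / q 1 - u.[0] / q 0; pose b := v.[1] / q 1 - v.[0] / q 0.
pose N := a ^+ 2 + b ^+ 2.
pose g t := (a *: u + b *: v).[t] * (q t)^-1.
pose dg t := (u^`().[t] * v.[t] - u.[t] * v^`().[t]) * (a * v.[t] - b * u.[t])
             / q t ^+ 3.
(* The projection of the unit vector on the chord (a, b) has this derivative; it
   moves by N, the squared length of the chord, between the end points. *)
have gd t : 0 <= t <= 1 -> is_derive t 1 g (dg t).
  move=> t01; have qt := q_gt0 t t01.
  have dS : is_derive S.[t] 1 Num.sqrt (2 * q t)^-1.
    by apply: is_derive1_sqrt; rewrite ES pos.
  have dq := is_derive1_comp dS (is_derive_poly S t).
  have qn0 : (Num.sqrt \o horner S) t != 0 by rewrite gt_eqF.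
  have dV := is_deriveV qn0 dq.
  have dW := is_deriveM (is_derive_poly (a *: u + b *: v) t) dV.
  apply: (trigger_derive dW).
  rewrite /dg /= -/(q t) ES' derivD !derivZ !(hornerD, hornerZ).
  rewrite /GRing.scale /=.
  have -> : q t ^+ 3 = q t * q t ^+ 2 by rewrite exprS.
  have -> : q t ^- 2 = (q t ^+ 2)^-1 by [].
  have Q := qq t t01; have : q t != 0 by rewrite gt_eqF.
  have : u.[t] ^+ 2 + v.[t] ^+ 2 != 0 by rewrite gt_eqF ?pos.
  rewrite !Q => h1 h2. field; rewrite ?h1 ?h2 //.
have dgB t : 0 <= t <= 1 -> dg t ^+ 2 <= th ^+ 2 * N.
  move=> t01; have qt := q_gt0 t t01.
  rewrite /dg expr_div_n ler_pdivrMr ?exprn_gt0 // -exprM.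
  rewrite exprMn -[(3 * 2)%N]/(2 * 3)%N exprM (qq t t01).
  have := slope t t01; have := pos t t01; rewrite /N.
  move: (u.[t]) (v.[t]) (u^`().[t]) (v^`().[t]) => x y x' y' p sl.
  set P := x ^+ 2 + y ^+ 2 in p sl *.
  have -> : th ^+ 2 * (a ^+ 2 + b ^+ 2) * P ^+ 3 =
    (th ^+ 2 * P * P) * ((a ^+ 2 + b ^+ 2) * P) by ring.
  apply: ler_pM; rewrite ?sqr_ge0 //.
    apply: le_trans (_ : (x' ^+ 2 + y' ^+ 2) * P <= _).
      rewrite -subr_ge0.
      suff -> : (x' ^+ 2 + y' ^+ 2) * P - (x' * y - x * y') ^+ 2
        = (x * x' + y * y') ^+ 2 by exact: sqr_ge0.
      by rewrite /P; ring.
    by rewrite ler_pM2r.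
  rewrite -subr_ge0.
  suff -> : (a ^+ 2 + b ^+ 2) * P - (a * y - b * x) ^+ 2
    = (a * x + b * y) ^+ 2 by exact: sqr_ge0.
  by rewrite /P; ring.
have N0 : 0 <= N by rewrite addr_ge0 ?sqr_ge0.
have gN : g 1 - g 0 = N.
  rewrite /g /N !(hornerD, hornerZ) /a /b; ring.
have NB : N <= th * Num.sqrt N.
  rewrite -{1}gN; apply: (bounded_slope gd) => t t01.
  apply: le_trans (ler_norm _) _.
  rewrite -(ler_pXn2r (n := 2)) ?nnegrE ?mulr_ge0 ?sqrtr_ge0 //.
  by rewrite exprMn sqr_sqrtr // -normrX ger0_norm ?sqr_ge0 ?dgB.
have {}NB : N <= th ^+ 2.
  have [N00|Np] := eqVneq N 0; first by rewrite N00 sqr_ge0.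
  have sN : 0 < Num.sqrt N by rewrite sqrtr_gt0 lt_def Np.
  have : Num.sqrt N <= th.
    by rewrite -(ler_pM2r sN) -{1}expr2 sqr_sqrtr.
  by move=> h; rewrite -[N]sqr_sqrtr // ler_pXn2r ?nnegrE ?sqrtr_ge0.
have EN : N = 2 - 2 * (u.[0] * u.[1] + v.[0] * v.[1]) / (q 0 * q 1).
  have := qq 0; have := qq 1; rewrite !lexx !ler01 => /(_ isT) Q1 /(_ isT) Q0.
  rewrite /N /a /b.
  transitivity ((u.[1] ^+ 2 + v.[1] ^+ 2) / q 1 ^+ 2
     + (u.[0] ^+ 2 + v.[0] ^+ 2) / q 0 ^+ 2
     - 2 * (u.[0] * u.[1] + v.[0] * v.[1]) / (q 0 * q 1)).
    by field; rewrite !gt_eqF.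
  by rewrite -Q1 -Q0 !divff ?expf_neq0 ?gt_eqF.
have q01 : 0 < q 0 * q 1 by rewrite mulr_gt0.
rewrite -ler_pdivlMr //.
move: NB; rewrite EN; lra.
Qed.

(** The derivative of ln (u^2 + v^2) is at most 2 [th]. *)
Lemma arc_growth u v th :
  (forall t, 0 <= t <= 1 -> 0 < u.[t] ^+ 2 + v.[t] ^+ 2) -> 0 <= th ->
  (forall t, 0 <= t <= 1 ->
    u^`().[t] ^+ 2 + v^`().[t] ^+ 2 <= th ^+ 2 * (u.[t] ^+ 2 + v.[t] ^+ 2)) ->
  Num.sqrt (u.[1] ^+ 2 + v.[1] ^+ 2) <=
    expR th * Num.sqrt (u.[0] ^+ 2 + v.[0] ^+ 2).
Proof.
move=> pos th0 slope.
pose S := u ^+ 2 + v ^+ 2.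
have ES t : S.[t] = u.[t] ^+ 2 + v.[t] ^+ 2 by rewrite !hornerE.
have S_gt0 t : 0 <= t <= 1 -> 0 < S.[t] by rewrite ES; exact: pos.
have ES' t : S^`().[t] = 2 * (u.[t] * u^`().[t] + v.[t] * v^`().[t]).
  by rewrite /S derivD !expr2 !derivM !(hornerD, hornerM); ring.
have gd t : 0 <= t <= 1 -> is_derive t 1 (@ln R \o horner S) (S.[t]^-1 * S^`().[t]).
  by move=> t01; apply: is_derive1_comp; exact: is_derive1_ln (S_gt0 t t01).
have : (@ln R \o horner S) 1 - (@ln R \o horner S) 0 <= 2 * th.
  apply: (bounded_slope gd) => t t01; have St := S_gt0 t t01.
  rewrite mulrC ler_pdivrMr // ES' -mulrA ler_pM2l //.
  have := slope t t01; rewrite -ES => sl.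
  apply: le_trans (ler_norm _) _.
  rewrite -(ler_pXn2r (n := 2)) ?nnegrE ?mulr_ge0 ?(ltW St) //.
  rewrite -normrX ger0_norm ?sqr_ge0 //.
  apply: le_trans (_ : (u^`().[t] ^+ 2 + v^`().[t] ^+ 2) * S.[t] <= _).
    rewrite ES -subr_ge0; set w := (X in 0 <= X).
    suff -> : w = (u.[t] * v^`().[t] - v.[t] * u^`().[t]) ^+ 2 by exact: sqr_ge0.
    by rewrite /w; ring.
  by rewrite exprMn [S.[t] ^+ 2]expr2 mulrA ler_pM2r.
have S0 : 0 < S.[0] by rewrite S_gt0 ?lexx ?ler01.
have S1 : 0 < S.[1] by rewrite S_gt0 ?lexx ?ler01.
rewrite /= -ln_div ?posrE // -ler_expR lnK ?posrE ?divr_gt0 // ler_pdivrMr //.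
rewrite -!ES => h.
rewrite -(ler_pXn2r (n := 2)) ?nnegrE ?mulr_ge0 ?sqrtr_ge0 ?expR_ge0 //.
by rewrite exprMn !sqr_sqrtr ?(ltW S0) ?(ltW S1) // -expRM_natl.
Qed.
End Arc.

Section Complex.
Variable R : realType.
Implicit Types (w z : R[i]) (th : R).

(** The modulus as an element of [R]; the norm of [R[i]] is [R[i]]-valued. *)
Definition cabs z : R := Normc.normc z.
(** The real part of [w * z^*], i.e. |w| |z| times the cosine of the angle
    between [w] and [z]. *)
Definition dot w z : R := Re w * Re z + Im w * Im z.

Lemma cabsE z : cabs z = Num.sqrt (Re z ^+ 2 + Im z ^+ 2).
Proof. by case: z. Qed.

Lemma cabs_ge0 z : 0 <= cabs z.
Proof. by rewrite cabsE sqrtr_ge0. Qed.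

Lemma sqr_cabs z : cabs z ^+ 2 = Re z ^+ 2 + Im z ^+ 2.
Proof. by rewrite cabsE sqr_sqrtr // addr_ge0 ?sqr_ge0. Qed.

Lemma cabs0 : cabs 0 = 0. Proof. exact: Normc.normc0. Qed.
Lemma cabs1 : cabs 1 = 1. Proof. exact: Normc.normc1. Qed.
Lemma cabsM w z : cabs (w * z) = cabs w * cabs z.
Proof. exact: Normc.normcM. Qed.
Lemma cabsV z : cabs z^-1 = (cabs z)^-1.
Proof. exact: Normc.normcV. Qed.
Lemma ler_cabsD w z : cabs (w + z) <= cabs w + cabs z.
Proof. exact: le_normcD. Qed.
Lemma cabsN z : cabs (- z) = cabs z.
Proof. exact: normcN. Qed.
Lemma cabs_eq0 z : (cabs z == 0) = (z == 0).
Proof.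
by apply/eqP/eqP => [/Normc.eq0_normc|->] //; exact: cabs0.
Qed.
Lemma cabs_gt0 z : (0 < cabs z) = (z != 0).
Proof. by rewrite lt_def cabs_eq0 cabs_ge0 andbT. Qed.
Lemma cabsX z n : cabs (z ^+ n) = cabs z ^+ n.
Proof. by elim: n => [|n IH]; rewrite ?expr0 ?cabs1 // !exprS cabsM IH. Qed.
Lemma cabs_real (x : R) : cabs x%:C%C = `|x|.
Proof. by rewrite cabsE /= expr0n /= addr0 sqrtr_sqr. Qed.
Lemma ler_cabs_sum (I : Type) (r : seq I) (P : pred I) (F : I -> R[i]) :
  cabs (\sum_(i <- r | P i) F i) <= \sum_(i <- r | P i) cabs (F i).
Proof.
elim/big_rec2: _ => [|i x y _ IH]; first by rewrite cabs0.
by apply: le_trans (ler_cabsD _ _) _; rewrite lerD2l.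
Qed.
Lemma cabs_prod (I : Type) (r : seq I) (P : pred I) (F : I -> R[i]) :
  cabs (\prod_(i <- r | P i) F i) = \prod_(i <- r | P i) cabs (F i).
Proof. by elim/big_rec2: _ => [|i x y _ <-]; rewrite ?cabs1 ?cabsM. Qed.
Lemma Re_sum (I : Type) (r : seq I) (P : pred I) (F : I -> R[i]) :
  Re (\sum_(i <- r | P i) F i) = \sum_(i <- r | P i) Re (F i).
Proof. by elim/big_rec2: _ => [|i x y _ <-] //; case: (F i) => ? ?; case: y. Qed.
Lemma Im_sum (I : Type) (r : seq I) (P : pred I) (F : I -> R[i]) :
  Im (\sum_(i <- r | P i) F i) = \sum_(i <- r | P i) Im (F i).
Proof. by elim/big_rec2: _ => [|i x y _ <-] //; case: (F i) => ? ?; case: y. Qed.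
Lemma Re_add w z : Re (w + z) = Re w + Re z. Proof. by case: w; case: z. Qed.
Lemma Im_add w z : Im (w + z) = Im w + Im z. Proof. by case: w; case: z. Qed.
Lemma Re_muln z n : Re (z *+ n) = Re z *+ n.
Proof. by elim: n => [|n IH] //; rewrite !mulrS Re_add IH. Qed.
Lemma Im_muln z n : Im (z *+ n) = Im z *+ n.
Proof. by elim: n => [|n IH] //; rewrite !mulrS Im_add IH. Qed.
Lemma Re_mul_real w (x : R) : Re (w * x%:C%C) = Re w * x.
Proof. by case: w => a b /=; rewrite mulr0 subr0. Qed.
Lemma Im_mul_real w (x : R) : Im (w * x%:C%C) = Im w * x.
Proof. by case: w => a b /=; rewrite mulr0 add0r. Qed.
Lemma ler_Re_cabs z : `|Re z| <= cabs z.
Proof.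
rewrite -(ler_pXn2r (n := 2)) ?nnegrE ?cabs_ge0 // sqr_cabs -normrX.
by rewrite ger0_norm ?sqr_ge0 // lerDl sqr_ge0.
Qed.

(** Expand the squared modulus of the sum into the pairwise products: if all
    pairwise cosines are at least [c ^+ 2], little cancels. *)
Lemma cone_sum (I : finType) (P : pred I) (F : I -> R[i]) (c : R) :
  0 <= c ->
  (forall i j, P i -> P j -> c ^+ 2 * (cabs (F i) * cabs (F j)) <= dot (F i) (F j)) ->
  c * \sum_(i | P i) cabs (F i) <= cabs (\sum_(i | P i) F i).
Proof.
move=> c0 h.
rewrite -(ler_pXn2r (n := 2)) ?nnegrE ?cabs_ge0 ?mulr_ge0 ?sumr_ge0 //; last first.
  by move=> i _; exact: cabs_ge0.
rewrite exprMn sqr_cabs Re_sum Im_sum !expr2 !big_distrlr /= -big_split /=.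
rewrite mulr_sumr; apply: ler_sum => i Pi.
by rewrite mulr_sumr -big_split /=; apply: ler_sum => j Pj; exact: h.
Qed.

Lemma horner_Re (f : {poly R[i]}) t : (map_poly (@Re R) f).[t] = Re f.[t%:C%C].
Proof.
have H0 : Re (0 : R[i]) = 0 by [].
rewrite (horner_coef_wide _ (size_poly _ _)) horner_coef Re_sum.
apply: eq_bigr => i _; rewrite -rmorphXn Re_mul_real coef_poly.
by rewrite ltn_ord.
Qed.
Lemma horner_Im (f : {poly R[i]}) t : (map_poly (@Im R) f).[t] = Im f.[t%:C%C].
Proof.
rewrite (horner_coef_wide _ (size_poly _ _)) horner_coef Im_sum.
apply: eq_bigr => i _; rewrite -rmorphXn Im_mul_real coef_poly.
by rewrite ltn_ord.
Qed.
Lemma deriv_Re (f : {poly R[i]}) : (map_poly (@Re R) f)^`() = map_poly (@Re R) f^`().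
Proof.
by apply/polyP => i; rewrite coef_deriv !coef_map_id0 // coef_deriv Re_muln.
Qed.
Lemma deriv_Im (f : {poly R[i]}) : (map_poly (@Im R) f)^`() = map_poly (@Im R) f^`().
Proof.
by apply/polyP => i; rewrite coef_deriv !coef_map_id0 // coef_deriv Im_muln.
Qed.

(** The two bounds above for the real and imaginary parts of [f]. The
    hypothesis bounds the logarithmic derivative of [f], which is how it is
    verified for partition functions. *)
Lemma turn_bound (f : {poly R[i]}) th : 0 <= th ->
  (forall t : R, 0 <= t <= 1 -> f.[t%:C%C] != 0) ->
  (forall t : R, 0 <= t <= 1 -> cabs f^`().[t%:C%C] <= th * cabs f.[t%:C%C]) ->
  (1 - th ^+ 2 / 2) * (cabs f.[0] * cabs f.[1]) <= dot f.[0] f.[1]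
  /\ cabs f.[1] <= expR th * cabs f.[0].
Proof.
move=> th0 nz slope.
pose u := map_poly (@Re R) f; pose v := map_poly (@Im R) f.
have E t : u.[t] ^+ 2 + v.[t] ^+ 2 = cabs f.[t%:C%C] ^+ 2.
  by rewrite sqr_cabs horner_Re horner_Im.
have pos t : 0 <= t <= 1 -> 0 < u.[t] ^+ 2 + v.[t] ^+ 2.
  by move=> t01; rewrite E exprn_gt0 // cabs_gt0 nz.
have sl t : 0 <= t <= 1 ->
    u^`().[t] ^+ 2 + v^`().[t] ^+ 2 <= th ^+ 2 * (u.[t] ^+ 2 + v.[t] ^+ 2).
  move=> t01; rewrite E deriv_Re deriv_Im horner_Re horner_Im -sqr_cabs -exprMn.
  by rewrite ler_pXn2r ?nnegrE ?mulr_ge0 ?cabs_ge0 ?slope.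
have := arc_chord th0 pos sl; have := arc_growth pos th0 sl.
by rewrite !E !sqrtr_sqr !ger0_norm ?cabs_ge0 // !horner_Re !horner_Im.
Qed.

End Complex.

(** * The sum over cliques and its zero-free polydisc *)

Section PartitionFunction.
Variables (F : comNzRingType) (V : finType) (m : nat).
Implicit Types (A S e : {set V}) (z d : {set V} -> F).

Definition clique_prod z S := \prod_(e : {set V} | (#|e| == 2) && (e \subset S)) z e.
(** The partition function restricted to the [m]-sets that contain [A]. The
    extra parameter [A] is what the induction for zero-freeness runs on. *)
Definition clique_sum z A :=
  \sum_(S : {set V} | (#|S| == m) && (A \subset S)) clique_prod z S.

(** Every [m]-set containing [A] has [m - #|A|] further elements. *)
Lemma clique_sum_extend z A : (#|A| <= m)%N ->
  \sum_(v | v \notin A) clique_sum z (v |: A) = (m - #|A|)%:R * clique_sum z A.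
Proof.
move=> Am; rewrite /clique_sum.
rewrite (exchange_big_dep (fun S : {set V} => (#|S| == m) && (A \subset S))) /=; last first.
  by move=> v S _ /andP[-> ]; rewrite subUset => /andP[_ ->].
rewrite mulr_sumr; apply: eq_bigr => S /andP[/eqP Sm AS].
rewrite (eq_bigl [in S :\: A]); last first.
  by move=> v /=; rewrite inE Sm eqxx subUset sub1set AS andbT.
rewrite sumr_const cardsD; have -> : S :&: A = A by apply/setIidPr.
by rewrite Sm mulr_natl.
Qed.

Lemma clique_sum_full z A : #|A| = m -> clique_sum z A = clique_prod z A.
Proof.
move=> Am; rewrite /clique_sum (big_pred1 A) // => S /=.
apply/andP/eqP => [[/eqP Sm AS]|->]; last by rewrite Am eqxx subxx.
by apply/esym/eqP; rewrite eqEcard AS Am Sm leqnn.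
Qed.

Lemma clique_sum_large z A : (m < #|A|)%N -> clique_sum z A = 0.
Proof.
move=> Am; rewrite /clique_sum big1 // => S /andP[/eqP Sm /subset_leq_card].
by rewrite Sm leqNgt Am.
Qed.

Lemma eq_clique_sum z z' A : (forall e, #|e| = 2 -> z e = z' e) -> clique_sum z A = clique_sum z' A.
Proof.
move=> zz; apply: eq_bigr => S _; apply: eq_bigr => e /andP[/eqP e2 _].
exact: zz.
Qed.

(** Used for a transposition of [i] and [j]: the sums over the sets through
    [j] and through [i] are the same function at two different points. *)
Lemma clique_sum_perm z A (p : {perm V}) :
  clique_sum z (p @: A) = clique_sum (fun e => z (p @: e)) A.
Proof.
have inj : injective (fun S : {set V} => p @: S) by apply/imset_inj/perm_inj.
have cardp S : #|p @: S| = #|S| by rewrite card_imset //; exact: perm_inj.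
have subp S S' : (p @: S \subset p @: S') = (S \subset S').
  apply/idP/idP; last exact: imsetS.
  move=> /subsetP h; apply/subsetP => x xS.
  by have := h (p x) (imset_f p xS); rewrite mem_imset //; exact: perm_inj.
rewrite /clique_sum (reindex_inj inj) /=; apply: eq_big => [S|S _].
  by rewrite cardp subp.
rewrite /clique_prod (reindex_inj inj) /=; apply: eq_bigl => e.
by rewrite cardp subp.
Qed.

End PartitionFunction.

Section Line.
Variables (F : fieldType) (V : finType) (m : nat).
Implicit Types (A S e : {set V}) (z d : {set V} -> F).

(** The partition function along the line through [z] with direction [d], as
    a polynomial in the parameter. *)
Definition segment_poly z d A : {poly F} :=
  clique_sum m (fun e => (z e)%:P + (d e) *: 'X) A.

Lemma horner_segment_poly z d A t :
  (segment_poly z d A).[t] = clique_sum m (fun e => z e + t * d e) A.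
Proof.
rewrite /segment_poly /clique_sum horner_sum; apply: eq_bigr => S _.
rewrite /clique_prod horner_prod; apply: eq_bigr => e _.
by rewrite !hornerE mulrC.
Qed.

(** Logarithmic differentiation of a product of affine factors. *)
Lemma deriv_prod_segment z d t (P : pred {set V}) :
  (forall e, P e -> z e + t * d e != 0) ->
  (\prod_(e | P e) ((z e)%:P + d e *: 'X))^`().[t]
  = \sum_(e | P e) d e / (z e + t * d e) * \prod_(e | P e) (z e + t * d e).
Proof.
move=> nz; rewrite -mulr_suml -!(big_filter _ P).
have {nz} : all (fun e => z e + t * d e != 0) [seq e <- index_enum _ | P e].
  by apply/allP => e; rewrite mem_filter => /andP[/nz].
elim: [seq _ <- _ | _] => [|e s IH] /=.
  by rewrite !big_nil derivC horner0 mul0r.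
case/andP => nze /IH E; rewrite !big_cons derivM hornerD !hornerM E.
rewrite horner_prod derivD derivC derivZ derivX.
have -> : \prod_(e' <- s) ((z e')%:P + d e' *: 'X).[t]
  = \prod_(e' <- s) (z e' + t * d e').
  by apply: eq_bigr => e' _; rewrite !hornerE mulrC.
rewrite !(hornerD, hornerZ, hornerC, hornerX) add0r mulr1 [d e * t]mulrC.
by field.
Qed.

(** Differentiating in the weight of [e] singles out the sets that contain
    [e], so the derivative is again made of restricted partition functions. *)
Lemma deriv_segment_poly z d A t :
  (forall e, #|e| = 2 -> z e + t * d e != 0) ->
  (segment_poly z d A)^`().[t]
  = \sum_(e : {set V} | #|e| == 2)
      d e / (z e + t * d e) * clique_sum m (fun e => z e + t * d e) (A :|: e).
Proof.
move=> nz; rewrite /segment_poly /clique_sum (big_morph _ (@derivD _) (@deriv0 _)) horner_sum.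
under eq_bigr => S _.
  rewrite deriv_prod_segment; last by move=> e /andP[/eqP /nz].
  over.
rewrite (exchange_big_dep (fun e : {set V} => #|e| == 2)) /=; last first.
  by move=> S e _ /andP[].
apply: eq_bigr => e e2; rewrite mulr_sumr.
by apply: eq_bigl => S; rewrite subUset e2 /= -!andbA.
Qed.

End Line.

Section ZeroFree.
Variables (R : realType) (V : finType) (m : nat).
Implicit Types (A B S e : {set V}) (z d : {set V} -> R[i]).
Local Notation P := (clique_sum m).

(** The closed polydisc of radius [del] around the all-ones point. *)
Definition near1 (del : R) z := forall e : {set V}, #|e| = 2 -> cabs (z e - 1) <= del.

(* [th] bounds the angle between the sums over two one-point extensions, [c ^+ 2] is
   a lower bound for its cosine, [E] bounds their quotient, and [r] is an upper bound
   for the fraction of the [m]-sets through a given set that contain one more point. *)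
Variables (del th c E r : R).
Hypotheses (mV : (m <= #|V|)%N) (del_ge0 : 0 <= del) (del_lt1 : del < 1)
  (th_ge0 : 0 <= th) (c_gt0 : 0 < c) (c_le1 : c <= 1)
  (c_th : c ^+ 2 <= 1 - th ^+ 2 / 2) (E_th : expR th <= E)
  (r_ratio : forall k, (0 < k <= m)%N -> (m - k)%:R <= r * (#|V| - k)%:R)
  (turn : 2 * del / (1 - del) * ((m.-1)%:R / c) * (1 + r * (E / c)) <= th).

(** All one-point extensions of a [k]-set give numbers of comparable size in
    a narrow cone. *)
Definition spread k := forall A z, #|A| = k -> near1 del z ->
  forall i j, i \notin A -> j \notin A ->
  c ^+ 2 * (cabs (P z (i |: A)) * cabs (P z (j |: A)))
    <= dot (P z (i |: A)) (P z (j |: A))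
  /\ cabs (P z (j |: A)) <= E * cabs (P z (i |: A)).

Definition nonvanishing k := forall A z, #|A| = k -> near1 del z -> P z A != 0.

Lemma E_ge1 : 1 <= E.
Proof. by apply: le_trans E_th; rewrite -expR0 ler_expR. Qed.

(** The weights stay away from 0, so dividing by them costs at most
    [1 / (1 - del)]. *)
Lemma near1_ge z e : near1 del z -> #|e| = 2 -> 1 - del <= cabs (z e).
Proof.
move=> zn e2; have := zn e e2.
have := ler_cabsD (z e) (1 - z e).
rewrite addrCA subrr addr0 cabs1 -[in cabs (1 - _)]opprB cabsN; lra.
Qed.

Lemma near1_neq0 z e : near1 del z -> #|e| = 2 -> z e != 0.
Proof.
move=> zn e2; rewrite -cabs_gt0; apply: lt_le_trans (near1_ge zn e2).
by rewrite subr_gt0.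
Qed.

(** The extended sets have more than [m] elements, and all sums are empty. *)
Lemma spread_large k : (m <= k)%N -> spread k.
Proof.
move=> mk A z Ak _ i j iA jA.
rewrite !clique_sum_large ?cardsU1 ?iA ?jA ?Ak //.
by rewrite cabs0 !mulr0 /dot /= !mulr0 addr0.
Qed.

Lemma nonvanishing_full : nonvanishing m.
Proof.
move=> A z Am zn; rewrite clique_sum_full //; apply/prodf_neq0 => e /andP[/eqP e2 _].
exact: near1_neq0 zn e2.
Qed.

(** By [cone_sum] the extensions of [A] hardly cancel in
    [clique_sum_extend]. *)
Lemma spread_sum k A z : spread k -> #|A| = k -> (k <= m)%N -> near1 del z ->
  c * \sum_(v | v \notin A) cabs (P z (v |: A)) <= (m - k)%:R * cabs (P z A).
Proof.
move=> sk Ak km zn.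
have -> : (m - k)%:R * cabs (P z A) = cabs (\sum_(v | v \notin A) P z (v |: A)).
  rewrite clique_sum_extend ?Ak // cabsM; congr (_ * _).
  by rewrite -(rmorph_nat (real_complex R)) cabs_real normr_nat.
apply: cone_sum; first exact: ltW.
by move=> i j iA jA; case: (sk A z Ak zn i j iA jA).
Qed.

(** No extension exceeds [E] times the average one, and the average over the
    [#|V| - k] extensions is about [(m - k) / (#|V| - k)] of the whole. This
    ratio, at most [r], is small when [m] is small compared with [#|V|], and
    then the radius can be larger. *)
Lemma spread_each k A z j : spread k -> #|A| = k -> (0 < k <= m)%N -> near1 del z ->
  j \notin A -> cabs (P z (j |: A)) <= r * (E / c) * cabs (P z A).
Proof.
move=> sk Ak /andP[k0 km] zn jA.
have E0 : 0 < E by apply: lt_le_trans E_ge1.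
have nk : (k < #|V|)%N.
  by rewrite -Ak -(cardsC A) -ltn_subLR // subnn card_gt0; apply/set0Pn; exists j; rewrite inE.
have card_out : \sum_(v | v \notin A) (1 : R) = (#|V| - k)%:R.
  rewrite (eq_bigl [in ~: A]) => [|v]; last by rewrite inE.
  by rewrite sumr_const cardsCs setCK Ak.
have := spread_sum sk Ak km zn; set sm := \sum_(v | _) _ => h.
have low : (#|V| - k)%:R * (cabs (P z (j |: A)) / E) <= sm.
  rewrite -card_out mulr_suml; apply: ler_sum => v vA.
  rewrite mul1r ler_pdivrMr // mulrC.
  by case: (sk A z Ak zn v j vA jA).
have nk0 : 0 < (#|V| - k)%:R :> R by rewrite ltr0n subn_gt0.
have rk := r_ratio (introT andP (conj k0 km)).
rewrite -(ler_pM2l nk0).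
rewrite -(ler_pM2l (divr_gt0 c_gt0 E0)).
apply: le_trans (_ : c * sm <= _).
  have -> : c / E * ((#|V| - k)%:R * cabs (P z (j |: A)))
     = c * ((#|V| - k)%:R * (cabs (P z (j |: A)) / E)) by field; rewrite gt_eqF.
  by rewrite ler_pM2l.
apply: le_trans h _.
have -> : c / E * ((#|V| - k)%:R * (r * (E / c) * cabs (P z A)))
  = r * (#|V| - k)%:R * cabs (P z A) by field; rewrite !gt_eqF.
by rewrite ler_wpM2r // cabs_ge0.
Qed.

(** The sum over all edges at a vertex [i] of [X]: an edge inside [X] does not
    change the sum, an edge leaving [X] is bounded by [spread_sum]. Together
    they count at most [m - 1] edges, whatever [X] is. *)
Lemma star_sum k (X : {set V}) z i : spread k -> #|X| = k -> near1 del z -> i \in X ->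
  \sum_(w | w != i) cabs (P z (w |: X)) <= (m.-1)%:R / c * cabs (P z X).
Proof.
move=> sk Xk zn iX.
have [km|mk] := leqP k m; last first.
  rewrite big1 ?mulr_ge0 ?invr_ge0 ?cabs_ge0 ?(ltW c_gt0) // => w _.
  rewrite clique_sum_large ?cabs0 // (leq_trans mk) // -Xk subset_leq_card //.
  exact: subsetUr.
have k0 : (0 < k)%N by rewrite -Xk card_gt0; apply/set0Pn; exists i.
rewrite (bigID (mem X)) /=.
have -> : \sum_(w | (w != i) && (w \in X)) cabs (P z (w |: X))
   = (k.-1)%:R * cabs (P z X).
  rewrite (eq_bigr (fun=> cabs (P z X))); last first.
    by move=> w /andP[_ wX]; congr (cabs (P z _)); apply/setUidPr; rewrite sub1set.
  rewrite (eq_bigl [in X :\ i]); last by move=> w; rewrite !inE.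
  by rewrite sumr_const -[in RHS]Xk (cardsD1 i X) iX /= mulr_natl.
rewrite (eq_bigl (fun w => w \notin X)); last first.
  by move=> w; case: eqP => // ->; rewrite iX.
have := spread_sum sk Xk km zn; set sm := \sum_(w | _) _ => h.
rewrite -(ler_pM2l c_gt0) mulrDr.
apply: le_trans (lerD (lexx _) h) _.
have -> : c * ((m.-1)%:R / c * cabs (P z X)) = (m.-1)%:R * cabs (P z X).
  by field; rewrite gt_eqF.
have -> : (m.-1)%:R = (k.-1)%:R + (m - k)%:R :> R.
  by rewrite -natrD -[in LHS](subnKC km); case: (k) k0.
rewrite [X in _ <= X]mulrDl lerD2r.
by rewrite -{2}[_ * cabs _]mul1r ler_wpM2r // mulr_ge0 ?cabs_ge0.
Qed.

(** A transposition of [i] and [j] displaces only the edges that contain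
    exactly one of them, which are the stars of [i] and of [j]. *)
Lemma moved_edges_sum i j (G : {set V} -> R) (d : {set V} -> R[i]) (a : R) : i != j ->
  (forall e, 0 <= G e) -> 0 <= a ->
  (forall e, #|e| = 2 -> cabs (d e) <= a) ->
  (forall e, (i \in e) = (j \in e) -> d e = 0) ->
  \sum_(e : {set V} | #|e| == 2) cabs (d e) * G e
  <= a * (\sum_(w | w != i) G [set i; w] + \sum_(w | w != j) G [set j; w]).
Proof.
move=> ij G0 a0 da d0.
have star_le (x : V) (Q : pred {set V}) :
   (forall e, Q e -> (#|e| == 2) && (x \in e)) ->
   \sum_(e | Q e) cabs (d e) * G e <= a * \sum_(w | w != x) G [set x; w].
  move=> Qx.
  have inj : {in [pred w | w != x] &, injective (fun w => [set x; w])}.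
    move=> w w' /= wx w'x /setP /(_ w); rewrite !inE eqxx orbT (negPf wx) /=.
    by move/esym/eqP.
  rewrite mulr_sumr.
  apply: le_trans (_ : \sum_(e in [set [set x; w] | w in [pred w | w != x]])
      a * G e <= _); last by rewrite big_imset.
  rewrite [X in _ <= X](bigID Q) /= [X in _ <= X + _](eq_bigl Q).
    rewrite -[X in X <= _]addr0 lerD //; last first.
      by apply: sumr_ge0 => e _; rewrite mulr_ge0.
    apply: ler_sum => e /Qx /andP[/eqP e2 _]; rewrite ler_wpM2r //; exact: da.
  move=> e; case Qe : (Q e); last by rewrite andbF.
  rewrite andbT; apply/imsetP.
  have /andP[/cards2P[y [y' [yy' ->]]]] := Qx e Qe.
  rewrite !inE => /orP[] /eqP ->; [exists y'|exists y] => //.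
  - by rewrite inE eq_sym.
  - by rewrite setUC.
rewrite (bigID (fun e : {set V} => i \in e)) /= mulrDr lerD //; first exact: star_le.
rewrite (bigID (fun e : {set V} => j \in e)) /=.
rewrite [X in _ + X]big1 ?addr0; first by apply: star_le => e /andP[/andP[-> _] ->].
move=> e /andP[/andP[_ ie] je]; rewrite d0 ?cabs0 ?mul0r //.
by rewrite (negPf ie) (negPf je).
Qed.

(** The sums through [i] and through [j] are the end values of the partition
    function on the segment from [z] to its image under the transposition. The
    whole segment lies in the polydisc, so the induction hypotheses bound the
    logarithmic derivative by [th] and [turn_bound] applies. *)
Lemma spread_step k : (k < m)%N -> nonvanishing k.+1 -> spread k.+1 -> spread k.+2 ->
  spread k.
Proof.
move=> km nz s1 s2 A z Ak zn i j iA jA.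
have [<-{j jA}|ij] := eqVneq i j.
  have E0 := E_ge1; have P0 := cabs_ge0 (P z (i |: A)); split; last first.
    by rewrite -{1}[cabs _]mul1r ler_wpM2r.
  rewrite /dot -!expr2 -sqr_cabs ler_piMl ?sqr_ge0 //.
  by rewrite exprn_ile1 // ltW.
pose p := tperm i j.
pose d e := z (p @: e) - z e.
pose f := segment_poly m z d (i |: A).
have card_p e : #|p @: e| = #|e| by rewrite card_imset //; exact: perm_inj.
(* [A] contains neither [i] nor [j], so the transposition fixes it pointwise. *)
have pA : p @: (i |: A) = j |: A.
  rewrite imsetU1 tpermL; congr (_ |: _).
  rewrite -[RHS]imset_id; apply: eq_in_imset => x xA.
  by rewrite tpermD //; apply: contraTneq xA => <-.
have f0 : f.[0] = P z (i |: A).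
  by rewrite horner_segment_poly; apply: eq_clique_sum => e _; rewrite mul0r addr0.
have f1 : f.[1] = P z (j |: A).
  rewrite horner_segment_poly -pA clique_sum_perm; apply: eq_clique_sum => e _.
  by rewrite mul1r /d addrC subrK.
have zt_near t : 0 <= t <= 1 -> near1 del (fun e => z e + t%:C%C * d e).
  move=> /andP[t0 t1] e e2.
  (* The polydisc is convex. *)
  have -> : z e + t%:C%C * d e - 1
     = (1 - t)%:C%C * (z e - 1) + t%:C%C * (z (p @: e) - 1).
    by rewrite /d rmorphB rmorph1; ring.
  apply: le_trans (ler_cabsD _ _) _; rewrite !cabsM !cabs_real.
  rewrite !ger0_norm ?subr_ge0 //.
  have h1 := zn e e2; have h2 : cabs (z (p @: e) - 1) <= del by rewrite zn ?card_p.
  have := ler_wpM2l t0 h2; have : 0 <= 1 - t by rewrite subr_ge0.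
  by move/ler_wpM2l => /(_ _ _ h1); lra.
have Bk : #|i |: A| = k.+1 by rewrite cardsU1 iA Ak.
rewrite -f0 -f1.
have [t t01|t t01|h1 h2] := @turn_bound R f th th_ge0.
- rewrite horner_segment_poly; apply: nz => //; exact: zt_near.
- have zt := zt_near t t01; set zt' := fun e => _ in zt.
  rewrite deriv_segment_poly; last by move=> e; exact: (near1_neq0 zt).
  rewrite horner_segment_poly -/zt'.
  set B := i |: A in Bk *.
  apply: le_trans (ler_cabs_sum _ _ _) _.
  apply: le_trans (_ : \sum_(e : {set V} | #|e| == 2)
      cabs (d e / zt' e) * cabs (P zt' (B :|: e)) <= _).
    apply: ler_sum => e _; rewrite [leLHS]cabsM; exact: lexx.
  have del1 : 0 < 1 - del by rewrite subr_gt0.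
  apply: le_trans (moved_edges_sum (a := 2 * del / (1 - del)) ij _ _ _ _) _.
  + by move=> e; exact: cabs_ge0.
  + by rewrite divr_ge0 ?mulr_ge0 // ltW.
  + move=> e e2; rewrite cabsM cabsV.
    apply: ler_pM; rewrite ?invr_ge0 ?cabs_ge0 //.
      have -> : d e = (z (p @: e) - 1) + - (z e - 1) by rewrite /d; ring.
      apply: le_trans (ler_cabsD _ _) _; rewrite cabsN.
      have h1 := zn e e2; have : cabs (z (p @: e) - 1) <= del by rewrite zn ?card_p.
      lra.
    rewrite lef_pV2 ?posrE ?cabs_gt0 ?(near1_neq0 zt) //.
    exact: near1_ge zt e2.
  + move=> e ie; rewrite /d (_ : p @: e = e) ?subrr ?mul0r //.
    apply/setP => x; rewrite -[x in LHS](tpermK i j) mem_imset; last exact: perm_inj.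
    by case: tpermP => [->|->|] //; rewrite ie.
  have iB : i \in B by rewrite !inE eqxx.
  have jB : j \notin B by rewrite !inE eq_sym negb_or ij jA.
  have B'k : #|j |: B| = k.+2 by rewrite cardsU1 jB Bk.
  have sum_i := star_sum s1 Bk zt iB.
  have sum_j := star_sum s2 B'k zt (setU11 j B).
  have each := spread_each s1 Bk km zt jB.
  rewrite (eq_bigr (fun w => cabs (P zt' (w |: B)))); last first.
    move=> w _; congr (cabs (P _ _)); rewrite setUC -setUA [w |: B]setUC.
    by apply/setUidPr; rewrite sub1set inE iB.
  rewrite [X in _ * (_ + X)](eq_bigr (fun w => cabs (P zt' (w |: (j |: B))))); last first.
    by move=> w _; congr (cabs (P _ _)); rewrite setUC -setUA setUCA.
  apply: le_trans (_ : 2 * del / (1 - del) * ((m.-1)%:R / c * (1 + r * (E / c))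
     * cabs (P zt' B)) <= _).
    rewrite ler_wpM2l ?divr_ge0 ?mulr_ge0 ?(ltW del1) //.
    have -> : (m.-1)%:R / c * (1 + r * (E / c)) * cabs (P zt' B)
      = (m.-1)%:R / c * cabs (P zt' B)
        + (m.-1)%:R / c * (r * (E / c) * cabs (P zt' B)) by ring.
    apply: lerD => //; apply: le_trans sum_j _.
    by rewrite ler_wpM2l // divr_ge0 // ltW.
  by apply: le_trans (ler_wpM2r (cabs_ge0 _) turn); rewrite !mulrA lexx.
- split.
    apply: le_trans h1; rewrite ler_wpM2r ?mulr_ge0 ?cabs_ge0 //.
  by apply: le_trans h2 _; rewrite ler_wpM2r ?cabs_ge0.
Qed.

(** Nonzero numbers in a narrow cone have a nonzero sum. *)
Lemma nonvanishing_step k : (k < m)%N -> nonvanishing k.+1 -> spread k ->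
  nonvanishing k.
Proof.
move=> km nz sk A z Ak zn.
have : (0 < #|~: A|)%N by rewrite cardsCs setCK Ak subn_gt0 (leq_trans km).
rewrite card_gt0 => /set0Pn[v]; rewrite inE => vA.
have := spread_sum sk Ak (ltnW km) zn.
apply: contraTneq => ->; rewrite cabs0 mulr0 -ltNge mulr_gt0 //.
rewrite (bigD1 v) //= ltr_wpDr ?sumr_ge0 // => [? _|]; first exact: cabs_ge0.
by rewrite cabs_gt0 nz // cardsU1 vA Ak.
Qed.

(** Descending induction on [#|A|], from [#|A| = m], where the sum is a single
    product, down to the empty set. The step for [k] needs the cone property
    for [k.+1] and [k.+2], since an edge adds up to two vertices. *)
Theorem clique_sum_neq0 z : near1 del z -> P z set0 != 0.
Proof.
have main k : (k <= m)%N ->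
   [/\ nonvanishing (m - k), spread (m - k) & spread (m - k).+1].
  elim: k => [|k IH] km.
    by rewrite subn0; split; [exact: nonvanishing_full|exact: spread_large|
      apply: spread_large; exact: leqnSn].
  have [nz s1 s2] := IH (ltnW km).
  have E1 : (m - k = (m - k.+1).+1)%N by rewrite -subSn.
  rewrite E1 in nz s1 s2.
  have lt : (m - k.+1 < m)%N by rewrite -E1 leq_subr.
  have s0 := spread_step lt nz s1 s2.
  by split => //; exact: nonvanishing_step.
by have [] := main m (leqnn m); rewrite subnn => nz _ _; apply: nz; rewrite cards0.
Qed.

End ZeroFree.

(** * Numerical radii of the polydisc *)

Section Radius.
Variables (R : realType).

Definition zero_free (gamma : R) (dom : nat -> nat -> bool) :=
  forall (V : finType) (m : nat) (z : {set V} -> R[i]),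
    (1 < m <= #|V|)%N -> dom #|V| m ->
    near1 (gamma / (m%:R - 1)) z -> clique_sum m z finset.set0 != 0.

(** With [del = gamma / (m - 1)] the factor [m - 1] of [star_sum] cancels, and
    the condition on the angle no longer involves [m]; [b] bounds [del]. *)
Lemma zero_free_of (gamma th c E r b : R) (dom : nat -> nat -> bool) :
  0 < gamma -> 0 <= b < 1 -> 0 <= th -> 0 < c <= 1 -> c ^+ 2 <= 1 - th ^+ 2 / 2 ->
  expR th <= E ->
  2 * gamma * (1 + r * (E / c)) <= th * c * (1 - b) ->
  (forall n m, (1 < m <= n)%N -> dom n m -> gamma / (m%:R - 1) <= b) ->
  (forall n m k, (1 < m <= n)%N -> dom n m -> (0 < k <= m)%N ->
      (m - k)%:R <= r * (n - k)%:R) ->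
  zero_free gamma dom.
Proof.
move=> g0 /andP[b0 b1] th0 /andP[c0 c1] cth Eth turn small ratio V m z mV dm zn.
have /andP[m1 mn] := mV.
have m10 : 0 < m%:R - 1 :> R by rewrite subr_gt0 (ltr_nat _ 1 m).
set del := gamma / _ in zn.
have del0 : 0 < del by rewrite divr_gt0.
have delb : del <= b := small _ _ mV dm.
have del1 : del < 1 := le_lt_trans delb b1.
have E0 : 0 < E := lt_le_trans (expR_gt0 th) Eth.
apply: (clique_sum_neq0 mn (ltW del0) del1 th0 c0 c1 cth Eth _ _ zn).
  by move=> k km; apply: ratio.
have -> : m.-1%:R = m%:R - 1 :> R by rewrite -subn1 natrB // ltnW.
have d1 : 0 < 1 - del by rewrite subr_gt0.
have -> : 2 * del / (1 - del) * ((m%:R - 1) / c) * (1 + r * (E / c))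
   = 2 * gamma * (1 + r * (E / c)) / (c * (1 - del)).
  have -> : gamma = del * (m%:R - 1) by rewrite /del divfK // gt_eqF.
  by field; rewrite !gt_eqF.
rewrite ler_pdivrMr ?mulr_gt0 //; apply: le_trans turn _.
by rewrite -mulrA ler_wpM2l // ler_wpM2l ?(ltW c0) // lerB.
Qed.

(** From [1 - 1 / 2 <= expR (- (1 / 2))]. *)
Lemma exp_half_le : expR (1 / 2 : R) <= 2.
Proof.
have := expR_ge1Dx (- (1 / 2) : R); rewrite expRN => h.
have : (2 : R)^-1 <= (expR (1 / 2))^-1 by lra.
by rewrite lef_pV2 ?posrE ?expR_gt0.
Qed.

(** From [(98 / 100) ^+ 40 <= expR (- (2 / 100)) ^+ 40]; the tangent bound on
    all of [0, 8 / 10] would be too weak. *)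
Lemma exp_8_10_le : expR (8 / 10 : R) <= 9 / 4.
Proof.
have h : (98 / 100 : R) <= expR (- (2 / 100)).
  by have := expR_ge1Dx (- (2 / 100) : R); lra.
have h40 : (98 / 100 : R) ^+ 40 <= (expR (8 / 10))^-1.
  rewrite -expRN; have -> : - (8 / 10) = 40%:R * - (2 / 100) :> R by lra.
  by rewrite expRM_natl lerXn2r // nnegrE ?expR_ge0 //; lra.
have : (4 / 9 : R) <= (98 / 100 : R) ^+ 40.
  have s1 : (96 / 100 : R) <= (98 / 100) ^+ 2 by lra.
  have s2 : (922 / 1000 : R) <= ((98 / 100) ^+ 2) ^+ 2 by lra.
  have s3 : (850 / 1000 : R) <= (((98 / 100) ^+ 2) ^+ 2) ^+ 2 by lra.
  lra.
move=> h2; have : (9 / 4 : R)^-1 <= (expR (8 / 10))^-1 by lra.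
by rewrite lef_pV2 ?posrE ?expR_gt0 //; lra.
Qed.

Lemma gamma_le_b (gamma b : R) m k : 0 < gamma -> (0 < k)%N -> (k < m)%N ->
  gamma / k%:R <= b -> gamma / (m%:R - 1) <= b.
Proof.
move=> g0 k0 km; apply: le_trans; rewrite ler_pM2l // lef_pV2 ?posrE ?ltr0n //.
  by rewrite lerBrDr natr1 ler_nat.
by rewrite subr_gt0 (ltr_nat _ 1 m) (leq_ltn_trans k0).
Qed.

(** The radius exceeds 6 / 100 by the factor 19 / 18. The angle 1 / 2 leaves
    room for the trivial ratio [r = 1]. *)
Lemma zero_free_all : zero_free (19 / 300) (fun n m => true).
Proof.
apply: (@zero_free_of _ (1 / 2) (935 / 1000) 2 1 (19 / 300)); try lra.
- exact: exp_half_le.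
- move=> n m /andP[m1 _] _; apply: (@gamma_le_b _ _ m 1 _ isT m1); first lra.
  by rewrite divr1 lexx.
- by move=> n m k /andP[_ mn] _ _; rewrite mul1r ler_nat leq_sub2r.
Qed.

(** The radius exceeds 18 / 100 by the factor 19 / 18. The angle 8 / 10 is
    close to the optimal one for the ratio [r = 1 / 4]; here [m >= 10] makes
    the radius of the polydisc at most 19 / 900. *)
Lemma zero_free_sparse :
  zero_free (19 / 100) (fun n m => (4 * m <= n) && (10 <= m))%N.
Proof.
apply: (@zero_free_of _ (8 / 10) (8246 / 10000) (9 / 4) (1 / 4) (19 / 900)); try lra.
- exact: exp_8_10_le.
- by move=> n m _ /andP[_ m10]; apply: (@gamma_le_b _ _ m 9); rewrite //; lra.
- move=> n m k _ /andP[mn _] _; rewrite mulrC mulrA mulr1 ler_pdivlMr //.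
  by rewrite -natrM ler_nat; lia.
Qed.

End Radius.

(** * Logarithm of a zero-free polynomial from its coefficients *)

Section Newton.
Variable F : fieldType.
Implicit Types (qs : seq F).

Definition power_sum qs i : F := \sum_(q <- qs) q ^+ i.

(** Newton's identities as one congruence modulo ['X^(K.+1)]: truncating the
    geometric series of [q 'X / (1 - q 'X)] leaves the multiple [W] of the next
    power. In this form the induction over the roots is a ring identity. *)
Lemma newton_poly qs K :
  exists W : {poly F},
    'X * (\prod_(q <- qs) (1 - q *: 'X))^`()
    + (\prod_(q <- qs) (1 - q *: 'X)) * (\sum_(i < K) power_sum qs i.+1 *: 'X^(i.+1))
    = W * 'X^(K.+1).
Proof.
elim: qs => [|q qs [W IH]].
  exists 0; rewrite big_nil derivC mulr0 add0r mul0r mul1r big1 // => i _.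
  by rewrite /power_sum big_nil scale0r.
exists ((1 - q *: 'X) * W - (q ^+ K.+1) *: \prod_(q <- qs) (1 - q *: 'X)).
pose S := \sum_(i < K) power_sum qs i.+1 *: 'X^(i.+1).
pose G := \sum_(i < K) q ^+ i.+1 *: ('X^(i.+1) : {poly F}).
have -> : \sum_(i < K) power_sum (q :: qs) i.+1 *: 'X^(i.+1) = S + G.
  rewrite -big_split /=; apply: eq_bigr => i _.
  by rewrite /power_sum big_cons scalerDl addrC.
have EG : (1 - q *: 'X) * G = q *: 'X - q ^+ K.+1 *: 'X^(K.+1).
  rewrite /G; elim: K {IH S G} => [|k IH]; first by rewrite big_ord0 mulr0 expr1 subrr.
  rewrite big_ord_recr /= mulrDr IH -!mul_polyC !exprS !polyCM; ring.
rewrite big_cons derivM.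
set Q := \prod_(q <- qs) _ in IH *.
have -> : (1 - q *: 'X)^`() = - q%:P :> {poly F}.
  by rewrite derivB derivC derivZ derivX sub0r alg_polyC.
have -> : 'X * (- q%:P * Q + (1 - q *: 'X) * Q^`()) + (1 - q *: 'X) * Q * (S + G)
  = (1 - q *: 'X) * ('X * Q^`() + Q * S) - q *: 'X * Q + Q * ((1 - q *: 'X) * G).
  by rewrite -!mul_polyC; ring.
rewrite IH EG -!mul_polyC; ring.
Qed.

Lemma newton qs k :
  k%:R * (\prod_(q <- qs) (1 - q *: 'X))`_k
  = - \sum_(1 <= i < k.+1) power_sum qs i * (\prod_(q <- qs) (1 - q *: 'X))`_(k - i).
Proof.
have [W] := newton_poly qs k.
set Q := \prod_(q <- qs) _ => /(congr1 (fun p : {poly F} => p`_k)).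
rewrite coefD coefMXn ltnSn coefXM mulr_sumr coef_sum => /eqP.
rewrite addr_eq0 => /eqP E.
transitivity (if k == 0%N then 0 else Q^`()`_k.-1).
  case: k E => [|k] _ /=; first by rewrite mul0r.
  by rewrite coef_deriv mulr_natl.
rewrite E big_add1 /= big_mkord; congr (- _); apply: eq_bigr => i _.
by rewrite -scalerAr coefZ coefMXn ltnNge ltn_ord.
Qed.

Lemma prod_lin_coef0 qs : (\prod_(q <- qs) (1 - q *: 'X : {poly F}))`_0 = 1.
Proof.
rewrite -horner_coef0 horner_prod big1 // => q _.
by rewrite hornerD hornerN hornerZ hornerX hornerC mulr0 subr0.
Qed.

(** The recursion determines the power sums one after the other, and it is
    also satisfied by the rescaled Taylor coefficients of the logarithm. *)
Lemma power_sum_unique qs (c l : nat -> F) K :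
  (forall k, (k <= K)%N -> c k = (\prod_(q <- qs) (1 - q *: 'X))`_k) ->
  (forall k, (0 < k <= K)%N ->
    k%:R * c k = \sum_(1 <= i < k.+1) i%:R * l i * c (k - i)%N) ->
  forall k, (0 < k <= K)%N -> power_sum qs k = - (k%:R * l k).
Proof.
move=> cQ lc; elim/ltn_ind => k IH /andP[k0 kK].
have := newton qs k; rewrite -cQ // lc ?k0 //.
rewrite !big_nat_recr //= subnn cQ // prod_lin_coef0 !mulr1.
 set A := \sum_(1 <= i < k) _; set B := \sum_(1 <= i < k) _.
have -> : B = - A.
  rewrite -sumrN; apply: eq_big_nat => i /andP[i0 ik].
  rewrite IH ?i0 ?(leq_trans (ltnW ik)) // mulNr cQ //.
  by rewrite (leq_trans (leq_subr _ _)).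
by rewrite opprD opprK => /addrI ->; rewrite opprK.
Qed.

End Newton.

Section LogSeries.
Variable R : realType.
Implicit Types (q w z : R[i]) (rho : R).

Lemma Re_div z w : Re (z / w) = dot z w / cabs w ^+ 2.
Proof.
rewrite sqr_cabs /dot; case: z w => a b [c d] /=; rewrite mulrN opprK.
by rewrite mulrDl !mulrA.
Qed.

(** The derivative of t |-> ln |1 - t q| is Re (- q / (1 - t q)), a geometric
    series; what the partial sum leaves out has modulus at most
    [rho ^+ K.+1 / (1 - rho)]. *)
Lemma log_factor q rho K : cabs q <= rho -> 0 < rho < 1 ->
  `| ln (cabs (1 - q)) + \sum_(k < K) Re (q ^+ k.+1) / k.+1%:R |
  <= rho ^+ K.+1 / (1 - rho).
Proof.
move=> qr /andP[r0 r1].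
have rho1 : 0 < 1 - rho by rewrite subr_gt0.
pose S : {poly R} := (1 - Re q *: 'X) ^+ 2 + (Im q *: 'X) ^+ 2.
pose L : {poly R} := \sum_(k < K) (Re (q ^+ k.+1) / k.+1%:R) *: 'X^(k.+1).
pose w (t : R) : R[i] := 1 - q * t%:C%C.
have w_ge t : 0 <= t <= 1 -> 1 - rho <= cabs (w t).
  move=> /andP[t0 t1].
  have := ler_cabsD (w t) (q * t%:C%C).
  rewrite subrK cabs1 cabsM cabs_real ger0_norm //.
  have : cabs q * t <= rho by rewrite (le_trans _ qr) // ler_piMr ?cabs_ge0.
  lra.
have w_gt t : 0 <= t <= 1 -> 0 < cabs (w t).
  by move=> /w_ge; apply: lt_le_trans.
have ES t : S.[t] = cabs (w t) ^+ 2.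
  rewrite sqr_cabs /w; case: (q) @S {w_ge w_gt} => a b /=.
  by rewrite !(hornerD, hornerN, hornerM, hornerZ, hornerX, hornerC); ring.
have ES' t : S^`().[t] = - (2 * dot q (w t)).
  rewrite /w; case: (q) @S {w_ge w_gt ES} => a b /=.
  rewrite /dot derivD !expr2 !derivM derivB derivC !derivZ derivX /=.
  by rewrite !(hornerD, hornerN, hornerM, hornerZ, hornerX, hornerC); ring.
have EL t : L^`().[t] = Re (\sum_(k < K) q ^+ k.+1 * (t ^+ k)%:C%C).
  rewrite /L (big_morph _ (@derivD _) (@deriv0 _)) horner_sum Re_sum.
  apply: eq_bigr => k _; rewrite Re_mul_real derivZ derivXn hornerZ hornerMn hornerXn /=.
  by rewrite -[t ^+ k *+ _]mulr_natl mulrA divfK // pnatr_eq0.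
pose g t := 2^-1 * (@ln R \o horner S) t + L.[t].
pose dg t := 2^-1 * (S.[t]^-1 * S^`().[t]) + L^`().[t].
have gd (t : R) : 0 <= t <= 1 -> is_derive t 1 g (dg t).
  move=> t01.
  have St : 0 < S.[t] by rewrite ES exprn_gt0 // w_gt.
  have dl := is_derive1_comp (is_derive1_ln St) (is_derive_poly S t).
  have dz := is_deriveZ (2^-1 : R) dl.
  exact: is_deriveD dz (is_derive_poly L t).
have dgB (t : R) : 0 <= t <= 1 -> `|dg t| <= rho ^+ K.+1 / (1 - rho).
  move=> t01; have wt := w_gt t t01; have wn : w t != 0 by rewrite -cabs_gt0.
  have -> : dg t = Re (- (q * (q * t%:C%C) ^+ K / w t)).
    have -> : - (q * (q * t%:C%C) ^+ K / w t)
      = - q / w t + \sum_(k < K) q ^+ k.+1 * (t ^+ k)%:C%C.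
      have -> : \sum_(k < K) q ^+ k.+1 * (t ^+ k)%:C%C
         = q * \sum_(k < K) (q * t%:C%C) ^+ k.
        rewrite mulr_sumr; apply: eq_bigr => k _.
        by rewrite exprMn exprS rmorphXn /= mulrA.
      have := subrX1 (q * t%:C%C) K; set sm := \sum_(k < K) _ => h.
      have -> : (q * t%:C%C) ^+ K = 1 - w t * sm.
        by rewrite /w -[LHS](subrK 1) h; ring.
      by field.
    rewrite Re_add Re_div -EL /dg ES ES'; congr (_ + _).
    have -> : dot (- q) (w t) = - dot q (w t).
      by rewrite /dot; case: (q) => a b /=; ring.
    by field; rewrite gt_eqF.
  apply: le_trans (ler_Re_cabs _) _.
  rewrite cabsN !cabsM cabsV cabsX cabsM cabs_real.
  case/andP: (t01) => t0 t1; rewrite (ger0_norm t0) exprS.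
  have qt : cabs q * t <= rho by rewrite (le_trans _ qr) // ler_piMr ?cabs_ge0.
  apply: ler_pM; rewrite ?mulr_ge0 ?exprn_ge0 ?invr_ge0 ?cabs_ge0 ?mulr_ge0 ?cabs_ge0 //.
    apply: ler_pM => //; rewrite ?exprn_ge0 ?mulr_ge0 ?cabs_ge0 //.
    by rewrite lerXn2r ?nnegrE ?mulr_ge0 ?cabs_ge0 ?(ltW r0).
  by rewrite lef_pV2 ?posrE //; exact: w_ge.
have g0 : g 0 = 0.
  rewrite /g /= ES /w rmorph0 mulr0 subr0 cabs1 expr1n ln1 mulr0 add0r.
  rewrite horner_sum big1 // => k _.
  by rewrite hornerZ hornerXn expr0n mulr0.
have g1 : g 1 = ln (cabs (1 - q)) + \sum_(k < K) Re (q ^+ k.+1) / k.+1%:R.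
  have c1 : 0 < cabs (1 - q).
    by have := w_gt 1; rewrite /w rmorph1 mulr1; apply; rewrite lexx ler01.
  rewrite /g /= ES /w rmorph1 mulr1 lnXn // -[ln _ *+ 2]mulr_natl mulrA mulVf ?mul1r ?pnatr_eq0 //.
  congr (_ + _); rewrite horner_sum; apply: eq_bigr => k _.
  by rewrite hornerZ hornerXn expr1n mulr1.
rewrite -g1 ler_norml; apply/andP; split.
  have gdN (t : R) : 0 <= t <= 1 -> is_derive t 1 (- g) (- dg t).
    by move=> t01; apply: is_deriveN; exact: gd.
  rewrite lerNl; have := bounded_slope gdN (B := rho ^+ K.+1 / (1 - rho)).
  rewrite !fctE g0 oppr0 subr0; apply => t t01.
  by apply: le_trans (dgB t t01); rewrite -normrN ler_norm.
have := bounded_slope gd (B := rho ^+ K.+1 / (1 - rho)).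
rewrite g0 subr0; apply => t t01.
by apply: le_trans (dgB t t01); rewrite ler_norm.
Qed.

Lemma log_prod (qs : seq R[i]) rho K : 0 < rho < 1 ->
  (forall q, q \in qs -> cabs q <= rho) ->
  `| ln (cabs (\prod_(q <- qs) (1 - q)))
     + \sum_(k < K) Re (power_sum qs k.+1) / k.+1%:R |
  <= (size qs)%:R * (rho ^+ K.+1 / (1 - rho)).
Proof.
move=> rho01; elim: qs => [|q qs IH] qsr.
  rewrite big_nil cabs1 ln1 mul0r add0r big1 ?normr0 // => k _.
  by rewrite /power_sum big_nil mul0r.
have qr : cabs q <= rho by apply: qsr; rewrite mem_head.
have {}IH := IH (fun x h => qsr x (mem_behead (s := q :: qs) h)).
have neq1 x : cabs x <= rho -> 0 < cabs (1 - x).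
  case/andP: rho01 => _ rho1.
  move=> xr; rewrite cabs_gt0 subr_eq0; apply: contraTneq xr => <-.
  by rewrite cabs1 -ltNge.
have pos : 0 < \prod_(q <- qs) cabs (1 - q).
  rewrite big_seq; apply: prodr_gt0 => x xqs; apply: neq1.
  by apply: qsr; rewrite inE xqs orbT.
have -> : \sum_(k < K) Re (power_sum (q :: qs) k.+1) / k.+1%:R
  = \sum_(k < K) Re (q ^+ k.+1) / k.+1%:R
    + \sum_(k < K) Re (power_sum qs k.+1) / k.+1%:R.
  rewrite -big_split; apply: eq_bigr => k _.
  by rewrite /power_sum big_cons Re_add mulrDl.
rewrite big_cons cabsM lnM ?posrE ?neq1 //; last by rewrite cabs_prod.
rewrite addrACA (le_trans (ler_normD _ _)) //=.
by rewrite -[X in X%:R]add1n natrD mulrDl mul1r lerD // log_factor.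
Qed.

End LogSeries.

Section LogTaylor.
Variable R : realType.
Implicit Types (rho : R).

(** The factorisation is written with inverse roots, so that the product has
    constant coefficient 1 and its logarithm a Taylor series at 0. *)
Lemma inverse_roots (P : {poly R[i]}) : P`_0 != 0 ->
  exists2 qs : seq R[i], P = P`_0 *: \prod_(q <- qs) (1 - q *: 'X) &
    (forall q, q \in qs -> q != 0 /\ root P q^-1) /\ size P = (size qs).+1.
Proof.
move=> P0; have [rs EP] := closed_field_poly_normal P.
have Pn : P != 0 by apply: contraNneq P0 => ->; rewrite coef0.
have lcn : lead_coef P != 0 by rewrite lead_coef_eq0.
have rsP z : z \in rs -> root P z.
  move=> zrs; rewrite EP rootZ // root_prod_XsubC //.
have rs0 z : z \in rs -> z != 0.
  move=> /rsP; apply: contraTneq => ->.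
  by rewrite rootE horner_coef0.
pose qs := [seq z^-1 | z <- rs].
have Eprod : \prod_(z <- rs) ('X - z%:P)
   = (\prod_(z <- rs) - z) *: \prod_(q <- qs) (1 - q *: 'X).
  rewrite /qs; elim: (rs) rs0 => [|z s IH] s0.
    by rewrite !big_nil scale1r.
  rewrite !big_cons IH; last by move=> x xs; apply: s0; rewrite inE xs orbT.
  have zn : z != 0 by apply: s0; rewrite mem_head.
  rewrite -!mul_polyC polyCM polyCN.
  have -> : 'X - z%:P = - z%:P * (1 - (z^-1)%:P * 'X).
    by rewrite mulrBr mulr1 mulNr mulrA -polyCM divff // mul1r opprK addrC.
  ring.
exists qs; last split.
- have EP' : P = (lead_coef P * \prod_(z <- rs) - z) *: \prod_(q <- qs) (1 - q *: 'X).
    by rewrite {1}EP Eprod scalerA.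
  by rewrite {1}EP'; congr (_ *: _); rewrite [in RHS]EP' coefZ prod_lin_coef0 mulr1.
- move=> q /mapP[z zrs ->]; rewrite invr_eq0 invrK; split; [exact: rs0|exact: rsP].
- by rewrite EP size_scale // size_prod_XsubC size_map.
Qed.

(** If [P] has no zero of modulus at most [rho^-1], its inverse roots have
    modulus at most [rho], and the Taylor series of its logarithm converges
    geometrically at 1. The hypothesis on [l] is [P * (ln P)' = P'] coefficient
    by coefficient, so [l] consists of the Taylor coefficients of [ln P]. *)
Theorem log_taylor (P : {poly R}) (N K : nat) rho (l : nat -> R) :
  0 < rho < 1 -> 0 < P`_0 -> 0 < P.[1] -> (size P <= N.+1)%N ->
  (forall z : R[i], cabs z <= rho^-1 -> (map_poly (real_complex R) P).[z] != 0) ->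
  (forall k, (0 < k <= K)%N ->
     k%:R * P`_k = \sum_(1 <= i < k.+1) i%:R * l i * P`_(k - i)) ->
  `| ln (P.[1] / P`_0) - \sum_(k < K) l k.+1 | <= N%:R * (rho ^+ K.+1 / (1 - rho))
  /\ `| \sum_(k < K) l k.+1 | <= N%:R * K%:R.
Proof.
move=> rho01 P0 P1 szP nz lP; have /andP[rho0 rho1] := rho01.
pose PC := map_poly (real_complex R) P.
have PC0 : PC`_0 = (P`_0)%:C%C by rewrite coef_map.
have PC0n : PC`_0 != 0 by rewrite PC0 (fmorph_eq0 (real_complex R)) gt_eqF.
have [qs EP [qsP szq]] := inverse_roots PC0n.
have szqs : (size qs <= N)%N.
  by rewrite -ltnS -szq size_map_poly.
have qr q : q \in qs -> cabs q <= rho.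
  move=> /qsP[q0]; apply: contraTle => qr; apply: nz.
  by rewrite cabsV lef_pV2 ?posrE ?cabs_gt0 // ltW.
have Eps k : (0 < k <= K)%N -> power_sum qs k = - (k%:R * (l k)%:C%C).
  apply: (@power_sum_unique _ qs (fun k => (P`_k / P`_0)%:C%C) (fun k => (l k)%:C%C) K).
    move=> j jK; apply: (mulfI PC0n); rewrite -coefZ -EP PC0 -rmorphM mulrC.
    by rewrite divfK ?gt_eqF // coef_map.
  move=> j jK; rewrite -(rmorph_nat (real_complex R)) -rmorphM mulrA lP //.
  rewrite mulr_suml rmorph_sum; apply: eq_bigr => i _.
  by rewrite -(rmorph_nat (real_complex R)) -!rmorphM /= !mulrA.
have EL : \sum_(k < K) l k.+1 = - \sum_(k < K) Re (power_sum qs k.+1) / k.+1%:R.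
  rewrite -sumrN; apply: eq_bigr => k _.
  rewrite Eps ?ltn_ord //= -(rmorph_nat (real_complex R)) -rmorphM -rmorphN /=.
  by rewrite mulNr opprK mulrC mulKf // pnatr_eq0.
have E1 : cabs (\prod_(q <- qs) (1 - q)) = P.[1] / P`_0.
  have := congr1 (fun p : {poly R[i]} => cabs p.[1]) EP.
  rewrite /PC -(rmorph1 (real_complex R)) horner_map cabs_real ger0_norm ?ltW //.
  rewrite hornerZ cabsM PC0 cabs_real (ger0_norm (ltW P0)) horner_prod => ->.
  rewrite mulrC mulKf ?gt_eqF //; congr (cabs _); apply: eq_bigr => q _.
  by rewrite hornerD hornerN hornerZ hornerX hornerC rmorph1 mulr1.
have c0 : 0 <= rho ^+ K.+1 / (1 - rho).
  by rewrite divr_ge0 ?exprn_ge0 ?subr_ge0 // ltW.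
split.
  rewrite EL opprK -E1; apply: le_trans (log_prod K rho01 qr) _.
  by rewrite ler_wpM2r // ler_nat.
rewrite EL normrN; apply: le_trans (ler_norm_sum _ _ _) _.
have edge_term k : `|Re (power_sum qs k.+1) / k.+1%:R| <= N%:R.
  rewrite normrM normfV normr_nat ler_pdivrMr ?ltr0n //.
  apply: le_trans (ler_Re_cabs _) _; apply: le_trans (ler_cabs_sum _ _ _) _.
  apply: le_trans (_ : \sum_(q <- qs) (1 : R) <= _).
    rewrite big_seq [X in _ <= X]big_seq; apply: ler_sum => q /qr qrho.
    by rewrite cabsX exprn_ile1 ?cabs_ge0 // (le_trans qrho) // ltW.
  rewrite big_const_seq count_predT iter_addr_0 -natrM ler_nat.
  by rewrite (leq_trans szqs) // leq_pmulr.
apply: (@le_trans _ _ (\sum_(k < K) N%:R)); first by apply: ler_sum.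
by rewrite sumr_const card_ord mulr_natr.
Qed.

End LogTaylor.

(** * A program logic with automatic time bounds *)

Definition Nat k := Cst k%:R.
Definition Var x := Read x (Cst 0).
Definition Assign x e := Write x (Cst 0) e.
Definition For x e p :=
  Seq (Assign x (Cst 0))
      (While (Op OpLt (Var x) e) (Seq p (Assign x (Op OpAdd (Var x) (Cst 1))))).

(** Exponent of the time bound: one level for sequencing or branching, two
    for a loop. *)
Fixpoint depth p : nat :=
  match p with
  | Skip | Write _ _ _ => 1
  | Seq p1 p2 | If _ p1 p2 => (maxn (depth p1) (depth p2)).+1
  | While _ p1 => (depth p1).+2
  end.

Section Logic.
Variable Z : nat.
Hypothesis Z_large : (1000 <= Z)%N.
Implicit Types (s : store) (p : prog) (Q : store -> Prop).

(** Termination in a state satisfying [Q], with a time bound read off the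
    syntax: if [Z] bounds the number of iterations of each loop, time is at
    most [Z ^ depth p], and proofs about programs need not count steps. *)
Definition runs s p Q := exists t s', [/\ exec s p t s', (t <= Z ^ depth p)%N & Q s'].

Lemma depth_gt0 p : (0 < depth p)%N. Proof. by case: p. Qed.

Lemma leq_expZ a b : (a <= b)%N -> (Z ^ a <= Z ^ b)%N.
Proof. by move=> ab; rewrite leq_pexp2l // (leq_trans _ Z_large). Qed.

Lemma runs_skip s Q : Q s -> runs s Skip Q.
Proof.
move=> Qs; exists 1, s; split=> //; first exact: exec_skip.
by rewrite expn1 (leq_trans _ Z_large).
Qed.

Lemma runs_write s x e1 e2 k v Q : (cost e1 + cost e2 < 1000)%N ->
  eval s e1 k%:R -> eval s e2 v -> Q (update s x k v) -> runs s (Write x e1 e2) Q.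
Proof.
move=> c h1 h2 Qs; eexists; eexists; split; [exact: (exec_write x h1 h2)| |exact: Qs].
by rewrite expn1 (leq_trans c).
Qed.

Lemma runs_seq s p q Q : runs s p (fun s' => runs s' q Q) -> runs s (Seq p q) Q.
Proof.
move=> [t [s1 [e1 b1 [t' [s2 [e2 b2 Q2]]]]]].
exists (t + t')%N, s2; split=> //; first exact: exec_seq e1 e2.
rewrite /= expnS.
have := leq_expZ (leq_maxl (depth p) (depth q)).
have := leq_expZ (leq_maxr (depth p) (depth q)).
by nia.
Qed.

Lemma runs_if s e v p1 p2 Q : (cost e < 900)%N ->
  eval s e v -> runs s (if v != 0 then p1 else p2) Q -> runs s (If e p1 p2) Q.
Proof.
move=> c ev [t [s1 [e1 b1 Q1]]].
exists (cost e + t).+1, s1; split=> //; first exact: exec_if ev e1.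
rewrite /= expnS.
set d := (if _ then p1 else p2) in b1.
have b2 : (Z ^ depth d <= Z ^ maxn (depth p1) (depth p2))%N.
  by apply: leq_expZ; rewrite /d; case: ifP => _; rewrite ?leq_maxl ?leq_maxr.
have b3 : (Z ^ 0 <= Z ^ maxn (depth p1) (depth p2))%N by apply: leq_expZ.
by rewrite expn0 in b3; nia.
Qed.

Lemma runs_mono s p Q Q' : (forall s', Q s' -> Q' s') -> runs s p Q -> runs s p Q'.
Proof. by move=> h [t [s1 [e1 b1 Q1]]]; exists t, s1; split=> //; apply: h. Qed.

Lemma eval_var s x v : s x 0 = v -> eval s (Var x) v.
Proof. by move=> <-; apply: (@eval_read s x (Cst 0) 0); exact: eval_cst. Qed.

Lemma runs_set s x e v Q : (cost e < 900)%N ->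
  eval s e v -> Q (update s x 0 v) -> runs s (Assign x e) Q.
Proof.
move=> c h Qs; apply: (@runs_write s x (Cst 0) e 0 v) => //=; last exact: eval_cst.
by rewrite add1n (leq_ltn_trans c).
Qed.

Lemma eval_lt s e1 e2 a b : eval s e1 a -> eval s e2 b ->
  eval s (Op OpLt e1 e2) (a < b)%R%:R.
Proof. by move=> h1 h2; apply: (eval_op h1 h2). Qed.

(** [Inv] is stated for the state before the test, when the counter already
    holds its new value. *)
Lemma runs_for (Inv : nat -> store -> Prop) N s x e p Q :
  (N <= Z)%N -> (cost e < 50)%N ->
  Inv 0 (update s x 0 0) ->
  (forall i s', (i <= N)%N -> Inv i s' -> s' x 0 = i%:R -> eval s' e N%:R) ->
  (forall i s', (i < N)%N -> Inv i s' -> s' x 0 = i%:R ->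
     runs s' p (fun s2 => s2 x 0 = i%:R /\ Inv i.+1 (update s2 x 0 i.+1%:R))) ->
  (forall s', Inv N s' -> Q s') ->
  runs s (For x e p) Q.
Proof.
move=> NZ ce I0 ebound body post.
apply: runs_seq; apply: (runs_set (v := 0)) => //; first exact: eval_cst.
set w := While _ _; set d := depth (Seq p (Assign x (Op OpAdd (Var x) (Cst 1)))).
have d0 : (0 < d)%N by exact: depth_gt0.
suff loop j s' : (j <= N)%N -> Inv (N - j)%N s' -> s' x 0 = (N - j)%:R ->
   exists t s2, [/\ exec s' w t s2, (t <= j * (100 + Z ^ d) + 100)%N & Inv N s2].
  have [||t [s2 [e2 b2 /post Q2]]] := loop N (update s x 0 0) (leqnn N).
  - by rewrite subnn.
  - by rewrite subnn /update !eqxx.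
  exists t, s2; split=> //; apply: leq_trans b2 _.
  rewrite -[depth w]/(d.+2) (expnS Z d.+1) (expnS Z d).
  have : (Z ^ 0 <= Z ^ d)%N by exact: leq_expZ.
  rewrite expn0; set y := (Z ^ d)%N; move=> y0.
  apply: (@leq_trans (Z * (100 + y) + 100)); first by rewrite leq_add ?leq_mul.
  have : (100 + y <= 101 * y)%N by lia.
  move=> h; apply: (@leq_trans (Z * (101 * y) + 100)).
    by rewrite leq_add ?leq_mul.
  have : (1000 * (Z * y) <= Z * (Z * y))%N by rewrite leq_mul.
  have : (1 <= Z * y)%N by rewrite muln_gt0 y0 andbT (leq_trans _ Z_large).
  lia.
elim: j s' => [|j IH] s' jN Is sx.
  rewrite subn0 in Is sx.
  exists (cost (Op OpLt (Var x) e)).+1, s'; split=> //; last by move=> /=; lia.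
  apply: exec_while_end.
  have := eval_lt (eval_var sx) (ebound N s' (leqnn N) Is sx).
  by rewrite ltxx.
have lt : (N - j.+1 < N)%N by lia.
have E : ((N - j.+1).+1 = N - j)%N by lia.
have [t1 [s1 [e1 b1 [s1x I1]]]] := body _ s' lt Is sx.
have step : exec s1 (Assign x (Op OpAdd (Var x) (Cst 1))) 6
    (update s1 x 0 (N - j)%:R).
  apply: (@exec_write s1 x (Cst 0) _ 0); first exact: eval_cst.
  rewrite -E -natr1; apply: (eval_op (eval_var s1x) (eval_cst _ _)) => //.
rewrite E in I1.
have [|t2 [s2 [e2 b2 I2]]] := IH (update s1 x 0 (N - j)%:R) (ltnW jN) I1.
  by rewrite /update !eqxx.
exists (cost (Op OpLt (Var x) e) + (t1 + 6) + t2).+1, s2; split=> //.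
  apply: (@exec_while_step _ (update s1 x 0 (N - j)%:R) _ _ 1) => //.
  - have := eval_lt (eval_var sx) (ebound _ s' (ltnW lt) Is sx).
    by rewrite ltr_nat lt.
  - exact: exec_seq e1 step.
have : (t1 + 6 <= Z ^ d)%N.
  rewrite -[d]/((maxn (depth p) 1).+1) (maxn_idPl (depth_gt0 p)) expnS.
  have := leq_expZ (leq0n (depth p)); rewrite expn0.
  by have := depth_gt0 p; nia.
rewrite /= mulSn; lia.
Qed.

End Logic.

(** * Program that lists the small edge sets *)

Definition touch (x : nat) (U : seq nat) := if x \in U then U else x :: U.
(** The vertices met by the edges of [I], without repetition and in the order
    in which the program marks them. *)
Definition touched (I : seq (nat * nat)) :=
  foldr (fun e U => touch e.2 (touch e.1 U)) [::] I.
(** One round of the enumeration: keep every listed set of pairs, and append a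
    copy containing [e] unless it would have more than [K] elements. *)
Definition add_edge K (l : seq (seq (nat * nat))) e :=
  l ++ [seq e :: J | J <- l & (size J < K)%N].
Definition edge_sets K es := foldl (add_edge K) [:: [::]] es.
Definition row_pairs u : seq (nat * nat) := [seq (u, v) | v <- iota 0 u].
(** Each unordered pair of indices once, the larger one first. *)
Definition pairs n := flatten [seq row_pairs u | u <- iota 0 n].

(** The probability that a random [m]-subset of an [n]-set contains a given
    [k]-subset. It vanishes for [k > m] because of the factor [i = m]. *)
Definition contain_prob (F : fieldType) (n m k : nat) : F :=
  \prod_(i < k) ((m%:R - i%:R) / (n%:R - i%:R)).

Definition sgn_adj (F : fieldType) (adj : nat -> nat -> bool) (g : F) (e : nat * nat) : F :=
  g * (2 * (adj e.1 e.2)%:R - 1).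

(** Contribution of the edge set [I] to a coefficient of the graph polynomial,
    relative to the constant coefficient. *)
Definition edge_term (F : fieldType) n m adj (g : F) (I : seq (nat * nat)) : F :=
  \prod_(e <- I) sgn_adj adj g e * contain_prob F n m (size (touched I)).

Lemma mem_touch x y U : (y \in touch x U) = (y == x) || (y \in U).
Proof.
rewrite /touch; case: ifP => xU; rewrite ?inE //.
by case: eqP => // ->.
Qed.

Lemma uniq_touch x U : uniq U -> uniq (touch x U).
Proof. by rewrite /touch; case: ifP => // xU uU /=; rewrite xU. Qed.

Lemma uniq_touched I : uniq (touched I).
Proof. by elim: I => //= e I IH; rewrite !uniq_touch. Qed.

Definition below n (U : seq nat) := all (fun x => x < n)%N U.

Lemma below_touch n x U : (x < n)%N -> below n U -> below n (touch x U).
Proof. by rewrite /touch; case: ifP => //= _ -> ->. Qed.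

(** An unmarked vertex exists, so the denominator [n - size U] is nonzero when
    the program divides by it. *)
Lemma size_below n x U : uniq U -> below n U -> (x < n)%N -> x \notin U ->
  (size U < n)%N.
Proof.
move=> uU bU xn xU.
have : uniq (x :: U) by rewrite /= xU.
move/uniq_leq_size => /(_ (iota 0 n)); rewrite size_iota; apply.
by move=> y; rewrite mem_iota inE => /predU1P[->//|/(allP bU)].
Qed.

Lemma edge_sets_cat K es es' : edge_sets K (es ++ es') = foldl (add_edge K) (edge_sets K es) es'.
Proof. exact: foldl_cat. Qed.

(* Array 0 holds the input sizes, array 1 the adjacency matrix and array 2 the
   output. The edge set number l of the list is kept in cell l of the arrays aVAL
   (its term), aDEG (its size) and aNUM (the number of touched vertices), and in
   row l of the matrix aMARK (the marks of these vertices). Arrays aCOEF and aLOG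
   hold the coefficients of the graph polynomial and of its logarithm; each of the
   others serves as a scalar variable, in its cell 0. *)
Notation aIN := 0%N.
Notation aADJ := 1%N.
Notation aOUT := 2%N.
Notation aVAL := 3%N.
Notation aDEG := 4%N.
Notation aNUM := 5%N.
Notation aMARK := 6%N.
Notation vLEN := 7%N.
Notation vU := 8%N.
Notation vV := 9%N.
Notation vI := 10%N.
Notation vW := 11%N.
Notation vOLD := 12%N.
Notation vK := 13%N.
Notation vQ := 14%N.
Notation vG := 15%N.
Notation aCOEF := 16%N.
Notation aLOG := 17%N.
Notation vJ := 18%N.
Notation vS := 19%N.
Notation vY := 20%N.
Notation vM := 21%N.
Notation vA := 22%N.

Declare Scope expr_scope.
Delimit Scope expr_scope with X.
Notation "e1 + e2" := (Op OpAdd e1 e2) : expr_scope.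
Notation "e1 - e2" := (Op OpSub e1 e2) : expr_scope.
Notation "e1 * e2" := (Op OpMul e1 e2) : expr_scope.
Notation "e1 / e2" := (Op OpDiv e1 e2) : expr_scope.
Notation "e1 < e2" := (Op OpLt e1 e2) : expr_scope.
Notation "p1 ;; p2" := (Seq p1 p2) (at level 70, right associativity).

Local Open Scope expr_scope.

Definition eN := Read aIN (Nat 0).
Definition eM := Read aIN (Nat 1).
(** Index of a cell in a matrix with rows of length [n]. *)
Definition Cell e1 e2 := (e1 * eN) + e2.

(** Marks the vertex held by the variable [x] in the last list entry, and
    multiplies the value of that entry by the next factor of [contain_prob]. *)
Definition prog_touch x :=
  If (Read aMARK (Cell (Var vLEN) (Var x))) Skip
    (Write aMARK (Cell (Var vLEN) (Var x)) (Nat 1) ;;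
     Write aVAL (Var vLEN) (Read aVAL (Var vLEN) *
        ((eM - Read aNUM (Var vLEN)) / (eN - Read aNUM (Var vLEN)))) ;;
     Write aNUM (Var vLEN) (Read aNUM (Var vLEN) + Nat 1)).

(** Builds the list entry number [vLEN] as entry [vI] with one more edge. *)
Definition prog_extend :=
  Write aNUM (Var vLEN) (Read aNUM (Var vI)) ;;
  Write aDEG (Var vLEN) (Read aDEG (Var vI) + Nat 1) ;;
  Write aVAL (Var vLEN) (Read aVAL (Var vI) *
     (Var vG * (Nat 2 * Read aADJ (Cell (Var vU) (Var vV)) - Nat 1))) ;;
  For vW eN (Write aMARK (Cell (Var vLEN) (Var vW))
                         (Read aMARK (Cell (Var vI) (Var vW)))) ;;
  prog_touch vU ;;
  prog_touch vV.

Definition prog_edge_sets :=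
  Write aVAL (Nat 0) (Nat 1) ;;
  Assign vLEN (Nat 1) ;;
  For vU eN (For vV (Var vU)
    (Assign vOLD (Var vLEN) ;;
     For vI (Var vOLD)
       (If (Read aDEG (Var vI) < Var vK)
          (prog_extend ;; Assign vLEN (Var vLEN + Nat 1))
          Skip))).

Local Close Scope expr_scope.

Section EdgeSets.
Variables (n m K : nat) (adj : nat -> nat -> bool) (g : rat) (Z : nat).
Hypothesis Z_large : (1000 <= Z)%N.
Hypothesis nZ : (n <= Z)%N.
Implicit Types (s : store) (I : seq (nat * nat)) (l : seq (seq (nat * nat))).
Local Notation runs := (runs Z).

Record env s := Env {
  env_n : s aIN 0 = n%:R;
  env_m : s aIN 1 = m%:R;
  env_adj : forall u v, (v < u < n)%N -> s aADJ (u * n + v)%N = (adj u v)%:R;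
  env_K : s vK 0 = K%:R;
  env_g : s vG 0 = g;
  env_coef : forall k, s aCOEF k = 0;
  env_Y : s vY 0 = 0 }.

Definition slot s j (U : seq nat) (v : rat) :=
  [/\ s aNUM j = (size U)%:R, s aVAL j = v * contain_prob rat n m (size U) &
      forall w, (w < n)%N -> s aMARK (j * n + w)%N = (w \in U)%:R].

(** The list entry number [j] represents the edge set [I]. *)
Definition entry s j I :=
  slot s j (touched I) (\prod_(e <- I) sgn_adj adj g e) /\ s aDEG j = (size I)%:R.

(** The cells that building the list entry number [j] may overwrite. *)
Definition scratch j y k :=
  [|| (y \in [:: aVAL; aDEG; aNUM]) && (k == j),
      (y == aMARK) && (j * n <= k < j * n + n)%N | y == vW].

Definition frame j s s' := forall y k, ~~ scratch j y k -> s' y k = s y k.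

Lemma frame_refl j s : frame j s s. Proof. by []. Qed.

Lemma frame_write j s s' x k v : frame j s s' -> scratch j x k ->
  frame j s (update s' x k v).
Proof.
move=> fr sc y l nsc; rewrite /update; case: ifP => [/andP[/eqP yx /eqP lk]|_].
  by rewrite yx lk sc in nsc.
exact: fr.
Qed.

Lemma frame_trans j s1 s2 s3 : frame j s1 s2 -> frame j s2 s3 -> frame j s1 s3.
Proof. by move=> h1 h2 y k nsc; rewrite h2 // h1. Qed.

Lemma frame_cell j s s' y k : frame j s s' -> ~~ (y \in [:: 3; 4; 5; 6; 11]%N) ->
  s' y k = s y k.
Proof.
move=> fr; rewrite !inE !negb_or => /and5P[h1 h2 h3 h4 h5]; apply: fr.
by rewrite /scratch !inE (negPf h1) (negPf h2) (negPf h3) (negPf h4) (negPf h5).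
Qed.

Lemma frame_env j s s' : frame j s s' -> env s -> env s'.
Proof.
move=> fr [h1 h2 h3 h4 h5 h6 h7]; split; try by rewrite (frame_cell _ fr).
- by move=> u v uv; rewrite (frame_cell _ fr) // h3.
- by move=> k; rewrite (frame_cell _ fr).
Qed.

Lemma cell_lt i j w : (i < j)%N -> (w < n)%N -> (i * n + w < j * n)%N.
Proof. by nia. Qed.

Lemma frame_entry j s s' i I : frame j s s' -> (i < j)%N -> entry s i I ->
  entry s' i I.
Proof.
move=> fr ij [[h1 h2 h3] h4].
have out y : y \in [:: aVAL; aDEG; aNUM] -> s' y i = s y i.
  move=> hy; apply: fr; rewrite /scratch hy (ltn_eqF ij) /=.
  by move: hy; rewrite !inE => /or3P[] /eqP ->.
split; [split|]; rewrite ?out // => w wn.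
rewrite -h3 //; apply: fr; rewrite /scratch !inE /=.
by rewrite leqNgt cell_lt.
Qed.

Lemma eval_add s e1 e2 a b c : eval s e1 a -> eval s e2 b -> a + b = c ->
  eval s (e1 + e2)%X c.
Proof. by move=> h1 h2 <-; apply: (eval_op h1 h2). Qed.
Lemma eval_sub s e1 e2 a b c : eval s e1 a -> eval s e2 b -> a - b = c ->
  eval s (e1 - e2)%X c.
Proof. by move=> h1 h2 <-; apply: (eval_op h1 h2). Qed.
Lemma eval_mul s e1 e2 a b c : eval s e1 a -> eval s e2 b -> a * b = c ->
  eval s (e1 * e2)%X c.
Proof. by move=> h1 h2 <-; apply: (eval_op h1 h2). Qed.
Lemma eval_div s e1 e2 a b c : eval s e1 a -> eval s e2 b -> b != 0 -> a / b = c ->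
  eval s (e1 / e2)%X c.
Proof. by move=> h1 h2 h3 <-; apply: (eval_op h1 h2). Qed.
Lemma eval_cell s x e k v : eval s e k%:R -> s x k = v -> eval s (Read x e) v.
Proof. by move=> h <-; apply: eval_read. Qed.
Lemma eval_nat s k : eval s (Nat k) k%:R. Proof. exact: eval_cst. Qed.

Lemma eval_n s : s aIN 0 = n%:R -> eval s eN n%:R.
Proof. by move=> h; apply: eval_cell (eval_nat _ _) h. Qed.
Lemma eval_m s : s aIN 1 = m%:R -> eval s eM m%:R.
Proof. by move=> h; apply: eval_cell (eval_nat _ _) h. Qed.

Lemma eval_Cell s e1 e2 j w : s aIN 0 = n%:R ->
  eval s e1 j%:R -> eval s e2 w%:R -> eval s (Cell e1 e2) (j * n + w)%:R.
Proof.
move=> h h1 h2; apply: eval_add (eval_mul h1 (eval_n h) (erefl _)) h2 _.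
by rewrite natrD natrM.
Qed.

Ltac read_at hi hv := eapply eval_cell; [eapply eval_var; exact hi|exact hv].

Lemma touch_ok s j U v x w : s aIN 0 = n%:R -> s aIN 1 = m%:R ->
  s vLEN 0 = j%:R -> s x 0 = w%:R -> (w < n)%N -> uniq U -> below n U ->
  x \in [:: vU; vV] -> slot s j U v ->
  runs s (prog_touch x) (fun s' =>
    [/\ frame j s s', slot s' j (touch w U) v & s' aDEG j = s aDEG j]).
Proof.
move=> hn hm hL hx wn uU bU xuv [h1 h2 h3].
have eL s' : s' vLEN 0 = j%:R -> eval s' (Var vLEN) j%:R by exact: eval_var.
have cellE : eval s (Cell (Var vLEN) (Var x)) (j * n + w)%:R.
  by apply: eval_Cell => //; apply: eval_var.
apply: (runs_if Z_large (v := (w \in U)%:R)) => //.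
  by apply: eval_cell cellE _; rewrite h3.
rewrite /touch; case: (boolP (w \in U)) => wU /=.
  by apply: (runs_skip Z_large); split; [exact: frame_refl|split|].
have su := size_below uU bU wn wU.
have nz : (n%:R - (size U)%:R : rat) != 0 by rewrite subr_eq0 eqr_nat gtn_eqF.
apply: (runs_seq Z_large); apply: (runs_write Z_large (k := (j * n + w)%N) (v := 1)) => //.
  exact: eval_nat.
apply: (runs_seq Z_large).
apply: (runs_write Z_large (k := j) (v := v * contain_prob rat n m (size U).+1)) => //.
- exact: eL.
- apply: eval_mul; first read_at hL h2.
    apply: eval_div; first (apply: eval_sub; first exact: eval_m).
    + read_at hL h1.
    + by [].
    + apply: eval_sub; first exact: eval_n.
        read_at hL h1.
      by [].
    + exact: nz.
    + by [].
  by rewrite /contain_prob big_ord_recr /= !mulrA.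
apply: (runs_write Z_large (k := j) (v := (size U).+1%:R)) => //.
- exact: eL.
- apply: eval_add; first read_at hL h1.
    exact: eval_nat.
  by rewrite -natrD addn1.
split=> //.
  apply: frame_write; last by rewrite /scratch !inE /= eqxx.
  apply: frame_write; last by rewrite /scratch !inE /= eqxx.
  apply: frame_write => //.
  by rewrite /scratch !inE /= leq_addr ltn_add2l wn.
split; rewrite /update /= ?eqxx //.
move=> w' w'n; rewrite /update /= eqn_add2l inE.
by case: eqP => //= _; rewrite h3.
Qed.

Lemma extend_ok s j u v i J : env s -> s vLEN 0 = j%:R -> s vU 0 = u%:R ->
  s vV 0 = v%:R -> s vI 0 = i%:R -> (i < j)%N -> (v < u < n)%N ->
  entry s i J -> below n (touched J) ->
  runs s prog_extend (fun s' => frame j s s' /\ entry s' j ((u, v) :: J)).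
Proof.
move=> es hL hu hv hi ij uvn eJ bJ; have [[i1 i2 i3] i4] := eJ.
have [hn hm hadj hK hg _ _] := es; have /andP[vu un] := uvn.
pose a := sgn_adj adj g (u, v).
pose p := \prod_(e <- J) sgn_adj adj g e.
have ji : (i == j) = false by rewrite ltn_eqF.
apply: (runs_seq Z_large); apply: (runs_write Z_large (k := j) (v := (size (touched J))%:R)) => //.
- by eapply eval_var; exact hL.
- by read_at hi i1.
set s1 := update _ _ _ _.
apply: (runs_seq Z_large); apply: (runs_write Z_large (k := j) (v := (size J).+1%:R)) => //.
- by eapply eval_var; exact hL.
- apply: (eval_add (a := (size J)%:R) (b := 1)); first by read_at hi i4.
    exact: eval_nat.
  by rewrite natr1.
set s2 := update _ _ _ _.
have r2 : s2 aVAL i = p * contain_prob rat n m (size (touched J)) by exact: i2.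
apply: (runs_seq Z_large).
apply: (runs_write Z_large (k := j) (v := a * p * contain_prob rat n m (size (touched J)))) => //.
- by eapply eval_var; exact hL.
- apply: eval_mul; first by read_at hi r2.
    apply: (eval_mul (b := 2 * (adj u v)%:R - 1)).
    + by eapply eval_var; exact hg.
    + apply: (eval_sub (a := 2 * (adj u v)%:R)).
      * apply: (eval_mul (eval_nat _ 2)); last by [].
        apply: (eval_cell (k := (u * n + v)%N)); last by apply: hadj.
        by apply: eval_Cell => //; eapply eval_var.
      * exact: eval_nat.
      * by [].
    + by [].
  by rewrite /a /sgn_adj /=; ring.
set s3 := update _ _ _ _.
have fr3 : frame j s s3.
  apply: frame_write; last by rewrite /scratch !inE /= eqxx.
  apply: frame_write; last by rewrite /scratch !inE /= eqxx.
  by apply: frame_write => //; rewrite /scratch !inE /= eqxx.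
apply: (runs_seq Z_large).
pose Inv q s' := [/\ frame j s s', s' aNUM j = (size (touched J))%:R,
   s' aDEG j = (size J).+1%:R, s' aVAL j = a * p * contain_prob rat n m (size (touched J)) &
   forall w, (w < q)%N -> s' aMARK (j * n + w)%N = (w \in touched J)%:R].
apply: (runs_for Z_large (Inv := Inv) (N := n)) => //.
- split=> //; rewrite /s3 /s2 /s1 /update /= ?eqxx //.
  exact: frame_write.
- move=> q s' _ [fr _ _ _ _] _; apply: eval_n.
  by rewrite (frame_cell _ fr).
- move=> q s' qn [fr k1 k2 k3 k4] hq.
  have hL' : s' vLEN 0 = j%:R by rewrite (frame_cell _ fr).
  have hi' : s' vI 0 = i%:R by rewrite (frame_cell _ fr).
  have hn' : s' aIN 0 = n%:R by rewrite (frame_cell _ fr).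
  have [[_ _ f3] _] := frame_entry fr ij eJ.
  apply: (runs_write Z_large (k := (j * n + q)%N) (v := (q \in touched J)%:R)) => //.
  + by apply: eval_Cell => //; apply: eval_var.
  + apply: (eval_cell (k := (i * n + q)%N)); last exact: f3.
    by apply: eval_Cell => //; apply: eval_var.
  + split; first by rewrite /update /=.
    split; rewrite ?/update //=.
      apply: frame_write => //; apply: frame_write => //.
      by rewrite /scratch !inE /= leq_addr ltn_add2l qn.
    move=> w; rewrite ltnS leq_eqVlt /update /= eqn_add2l.
    by case: eqP => [-> //|_] /= /k4.
move=> s4 [fr4 k1 k2 k3 k4].
have env4 := frame_env fr4 es; have [hn4 hm4 _ _ _ _ _] := env4.
apply: (runs_seq Z_large).
have sl4 : slot s4 j (touched J) (a * p) by split.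
apply: runs_mono; last first.
  apply: (touch_ok (x := vU) hn4 hm4 _ _ un _ bJ _ sl4) => //.
  - by rewrite (frame_cell _ fr4).
  - by rewrite (frame_cell _ fr4).
  - exact: uniq_touched.
move=> s5 [fr5 sl5 d5]; have env5 := frame_env fr5 env4; have [hn5 hm5 _ _ _ _ _] := env5.
have vn : (v < n)%N by exact: ltn_trans un.
apply: runs_mono; last first.
  apply: (touch_ok (x := vV) hn5 hm5 _ _ vn _ _ _ sl5) => //.
  - by rewrite (frame_cell _ fr5) // (frame_cell _ fr4).
  - by rewrite (frame_cell _ fr5) // (frame_cell _ fr4).
  - exact/uniq_touch/uniq_touched.
  - exact: below_touch.
move=> s6 [fr6 sl6 d6]; split; first exact: frame_trans fr4 (frame_trans fr5 fr6).
split; first by rewrite /= big_cons.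
by rewrite d6 d5.
Qed.

(** The list in memory represents the edge sets [l]. *)
Definition list_state l s :=
  [/\ env s, s vLEN 0 = (size l)%:R,
      forall i, (i < size l)%N -> entry s i (nth [::] l i) &
      all (fun J => below n (touched J)) l].

Lemma list_state_ext l s s' :
  (forall y k, ~~ (y \in [:: vU; vV; vI; vW; vOLD]) -> s' y k = s y k) ->
  list_state l s -> list_state l s'.
Proof.
move=> h [[h1 h2 h3 h4 h5 h6 h7] h8 h9 h10].
split; rewrite ?h //.
  split; rewrite ?h //; last by move=> k; rewrite h.
  by move=> u v uv; rewrite h // h3.
move=> i il; have [[k1 k2 k3] k4] := h9 i il.
by split; [split|]; rewrite ?h // => w wn; rewrite h // k3.
Qed.

Lemma list_state_counter l s x v : x \in [:: vU; vV; vI; vW; vOLD] ->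
  list_state l s -> list_state l (update s x 0 v).
Proof.
move=> xc; apply: list_state_ext => y k yc; rewrite /update; case: eqP => // yx.
by rewrite yx xc in yc.
Qed.

Lemma list_state_rcons l J s s' : list_state l s -> frame (size l) s s' ->
  entry s' (size l) J -> below n (touched J) ->
  list_state (rcons l J) (update s' vLEN 0 (size l).+1%:R).
Proof.
move=> [es hL hl bl] fr eJ bJ.
have upd y k : (y == vLEN) = false -> update s' vLEN 0 (size l).+1%:R y k = s' y k.
  by rewrite /update => ->.
have ent i J' : entry s' i J' -> entry (update s' vLEN 0 (size l).+1%:R) i J'.
  by move=> [[k1 k2 k3] k4].
split.
- by case: (frame_env fr es) => h1 h2 h3 h4 h5 h6 h7; split.
- by rewrite size_rcons /update.
- move=> i; rewrite size_rcons ltnS leq_eqVlt => /predU1P[->|il].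
    by apply: ent; rewrite nth_rcons ltnn eqxx.
  by apply: ent; rewrite nth_rcons il; apply: frame_entry fr il (hl i il).
- by rewrite all_rcons bJ.
Qed.

(** The inner loop stops at the old length of the list, so entries appended in
    this round are not visited. *)
Lemma add_edge_ok l s u v : list_state l s -> s vU 0 = u%:R -> s vV 0 = v%:R ->
  (v < u < n)%N -> (size l <= Z)%N ->
  runs s (Seq (Assign vOLD (Var vLEN)) (For vI (Var vOLD)
       (If (Op OpLt (Read aDEG (Var vI)) (Var vK))
          (Seq prog_extend (Assign vLEN (Op OpAdd (Var vLEN) (Nat 1)))) Skip)))
    (fun s' => [/\ list_state (add_edge K l (u, v)) s', s' vU 0 = u%:R & s' vV 0 = v%:R]).
Proof.
move=> rl hu hv uvn lZ.
have [_ hL _ _] := rl.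
apply: (runs_seq Z_large); apply: (runs_set Z_large (v := (size l)%:R)) => //.
  exact: eval_var.
pose ext i := l ++ [seq (u, v) :: J | J <- take i l & (size J < K)%N].
pose Inv i s' := [/\ list_state (ext i) s', s' vOLD 0 = (size l)%:R, s' vU 0 = u%:R
  & s' vV 0 = v%:R].
apply: (runs_for Z_large (Inv := Inv) (N := size l)) => //.
- split=> //; rewrite /ext take0 /= cats0.
  by do 2!apply: list_state_counter => //.
- by move=> i s' _ [_ h _ _] _; apply: eval_var.
- move=> i s' il [r' ho hu' hv'] hi.
  have [es' hL' hl' bl'] := r'.
  pose J := nth [::] l i.
  have iext : (i < size (ext i))%N by rewrite size_cat ltn_addr.
  have nthJ : nth [::] (ext i) i = J by rewrite nth_cat il.
  have eJ := hl' i iext; rewrite nthJ in eJ; have [_ dJ] := eJ.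
  have bJ : below n (touched J).
    by rewrite -nthJ; apply: (all_nthP [::] bl' i iext).
  have extS : ext i.+1 = if (size J < K)%N then rcons (ext i) ((u, v) :: J) else ext i.
    rewrite /ext (take_nth [::] il) filter_rcons -/J; case: ifP => // _.
    by rewrite map_rcons -rcons_cat.
  apply: (runs_if Z_large (v := ((size J)%:R < K%:R :> rat)%R%:R)) => //.
    apply: eval_lt; first by read_at hi dJ.
    by eapply eval_var; exact (env_K es').
  rewrite ltr_nat; case sJ : (size J < K)%N; rewrite ?oner_eq0 ?eqxx /=; last first.
    apply: (runs_skip Z_large); split=> //; split=> //.
    by apply: list_state_counter => //; rewrite extS sJ.
  apply: (runs_seq Z_large); apply: runs_mono; last first.
    exact: (extend_ok es' hL' hu' hv' hi iext uvn eJ bJ).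
  move=> s2 [fr e2].
  have fc y : ~~ (y \in [:: 3; 4; 5; 6; 11]%N) -> s2 y 0 = s' y 0.
    by move=> yn; rewrite (frame_cell _ fr).
  apply: (runs_set Z_large (v := (size (ext i)).+1%:R)) => //.
    apply: (eval_add (a := (size (ext i))%:R) (b := 1)); last by rewrite natr1.
      by apply: eval_var; rewrite fc.
    exact: eval_nat.
  split; first by rewrite /update /= fc.
  split; try by rewrite /update /= fc.
  apply: list_state_counter => //; rewrite extS sJ; apply: list_state_rcons r' fr e2 _.
  have /andP[vu un] := uvn.
  by rewrite /= !below_touch // (ltn_trans vu).
- move=> s' [r' _ hu' hv']; split=> //.
  by move: r'; rewrite /ext take_size.
Qed.

Lemma size_add_edges l es : (size l <= size (foldl (add_edge K) l es))%N.
Proof.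
elim: es l => //= e es IH l; apply: leq_trans (IH _).
by rewrite size_cat leq_addr.
Qed.

Lemma iota_rcons i : iota 0 i.+1 = rcons (iota 0 i) i.
Proof. by rewrite -addn1 iotaD add0n cats1. Qed.

Lemma size_edge_sets_prefix es es' : (size (edge_sets K es) <= size (edge_sets K (es ++ es')))%N.
Proof. by rewrite edge_sets_cat size_add_edges. Qed.

(** The pairs processed before the pair [(u, v)]. *)
Definition pairs_before u v :=
  flatten [seq row_pairs u' | u' <- iota 0 u] ++ [seq (u, v') | v' <- iota 0 v].

Lemma pairs_before_row u v : pairs_before u v.+1 = rcons (pairs_before u v) (u, v).
Proof. by rewrite /pairs_before iota_rcons map_rcons rcons_cat. Qed.

Lemma pairs_before_next u : pairs_before u u = pairs_before u.+1 0.
Proof. by rewrite /pairs_before iota_rcons map_rcons flatten_rcons cats0. Qed.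

Lemma pairs_before_prefix u v : (u < n)%N -> (v <= u)%N ->
  exists es, pairs n = pairs_before u v ++ es.
Proof.
move=> un vu.
have -> : pairs n = flatten [seq row_pairs u' | u' <- iota 0 u] ++ row_pairs u
    ++ flatten [seq row_pairs u' | u' <- iota u.+1 (n - u.+1)].
  by rewrite /pairs -{1}(subnKC un) iotaD map_cat flatten_cat iota_rcons
    map_rcons flatten_rcons -catA.
have -> : row_pairs u = [seq (u, v') | v' <- iota 0 v]
    ++ [seq (u, v') | v' <- iota v (u - v)].
  by rewrite -map_cat -[X in iota X (u - v)]add0n -iotaD subnKC.
by rewrite /pairs_before; eexists; rewrite -!catA; reflexivity.
Qed.

Lemma edge_sets_ok s : (size (edge_sets K (pairs n)) <= Z)%N -> env s ->
  s aDEG 0 = 0 -> s aNUM 0 = 0 -> (forall k, s aMARK k = 0) ->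
  runs s prog_edge_sets (list_state (edge_sets K (pairs n))).
Proof.
move=> LZ es hd hn hm.
apply: (runs_seq Z_large); apply: (runs_write Z_large (k := 0) (v := 1)) => //;
  try exact: eval_nat.
apply: (runs_seq Z_large); apply: (runs_set Z_large (v := 1)) => //.
  exact: eval_nat.
apply: (runs_for Z_large (Inv := fun u => list_state (edge_sets K (pairs_before u 0))) (N := n)) => //.
- case: (es) => h1 h2 h3 h4 h5 h6 h7; split=> //; case=> // _.
  split=> //; split=> //; first by rewrite /update /= big_nil /contain_prob big_ord0 mulr1.
  by move=> w wn; rewrite /update /= hm.
- by move=> u s' _ [[h _ _ _ _ _ _] _ _ _] _; apply: eval_n.
- move=> u s' un r' hu.
  apply: (runs_for Z_large (N := u)
    (Inv := fun v s2 => list_state (edge_sets K (pairs_before u v)) s2 /\ s2 vU 0 = u%:R)) => //.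
  + exact: ltnW (leq_trans un nZ).
  + by split; [exact: list_state_counter|].
  + by move=> v s2 _ [_ h] _; apply: eval_var.
  + move=> v s2 vu [r2 hu2] hv.
    apply: runs_mono; last first.
      apply: (add_edge_ok (u := u) (v := v) r2 hu2 hv); first by rewrite vu.
      have [es' E] := pairs_before_prefix un (ltnW vu).
      by apply: leq_trans LZ; rewrite E size_edge_sets_prefix.
    move=> s3 [r3 hu3 hv3]; split=> //; split=> //.
    apply: list_state_counter => //.
    by move: r3; rewrite pairs_before_row -cats1 edge_sets_cat.
  + move=> s2 [r2 hu2]; split=> //.
    by apply: list_state_counter => //; rewrite -pairs_before_next.
- by move=> s'; rewrite /pairs_before cats0.
Qed.

End EdgeSets.

(** * The complete program and its output *)

Local Open Scope expr_scope.

(** Computes [g] and 156 times the number of doublings needed to reach [m]. *)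
Definition prog_init gq :=
  Assign vG (Cst gq / (eM - Nat 1)) ;;
  Assign vQ (Nat 1) ;;
  For vJ eM
    (If (Var vQ < eM)
       (Assign vQ (Var vQ + Var vQ) ;; Assign vK (Var vK + Nat 156)) Skip).

Definition prog_collect :=
  For vI (Var vLEN)
    (Write aCOEF (Read aDEG (Var vI))
       (Read aCOEF (Read aDEG (Var vI)) + Read aVAL (Var vI))).

(** The recursion of [log_coefs], accumulating the sum of the logarithm's
    coefficients in [vY]. *)
Definition prog_log :=
  For vI (Var vK)
    (Assign vS (Nat 0) ;;
     For vJ (Var vI)
       (Assign vS (Var vS + (Var vJ + Nat 1) * Read aLOG (Var vJ + Nat 1)
                          * Read aCOEF (Var vI - Var vJ))) ;;
     Write aLOG (Var vI + Nat 1)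
       (Read aCOEF (Var vI + Nat 1) - Var vS / (Var vI + Nat 1)) ;;
     Assign vY (Var vY + Read aLOG (Var vI + Nat 1))).

(** The exponential is replaced by the power [(1 + Y / M) ^+ M], which needs
    only arithmetic. *)
Definition prog_output gq :=
  Assign vY (Var vY + Cst gq * eM) ;;
  Assign vS (eM * eM * (Var vK + Nat 1)) ;;
  Assign vM (Nat 100 * Var vS * Var vS) ;;
  Assign vS (Nat 1 + Var vY / Var vM) ;;
  Assign vA (Nat 1) ;;
  For vI (Var vM) (Assign vA (Var vA * Var vS)) ;;
  For vI eM (Assign vA (Var vA * ((eN - Var vI) / (Var vI + Nat 1)))) ;;
  For vI eM (For vJ (Var vI) (Assign vA (Var vA / (Nat 1 + Var vG)))) ;;
  Assign aOUT (Var vA).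

Definition density_prog gq :=
  prog_init gq ;; prog_edge_sets ;; prog_collect ;; prog_log ;; prog_output gq.

Local Close Scope expr_scope.

(** The degree of the Taylor polynomial, of order ln m. Since
    [(18 / 19) ^+ 13 <= 1 / 2], it makes the tail smaller than [m ^+ 2 / m ^+ 12]
    up to a constant. *)
Definition taylor_order m := (156 * up_log 2 m)%N.
(** 100 times the square of a bound for the exponent [Y]. *)
Definition exp_steps m K := (100 * (m * m * K.+1) * (m * m * K.+1))%N.

(** The recursion satisfied by the Taylor coefficients [l] of the logarithm of
    a power series [c] with constant coefficient 1. *)
Definition log_coefs (F : fieldType) (c l : nat -> F) K :=
  forall k, (k < K)%N ->
    l k.+1 = c k.+1 - (\sum_(j < k) j.+1%:R * l j.+1 * c (k - j)%N) / k.+1%:R.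

Section Program.
Variables (n m : nat) (adj : nat -> nat -> bool) (gq : rat) (Z : nat).
Hypothesis Z_large : (1000 <= Z)%N.
Hypothesis nZ : (n <= Z)%N.
Hypotheses (m_gt1 : (1 < m)%N) (mn : (m <= n)%N) (gq_gt0 : 0 < gq).
Implicit Types (s : store).
Local Notation runs := (runs Z).
Let K := taylor_order m.
Let g := gq / (m%:R - 1).
Let lst := edge_sets K (pairs n).
Let coef k := \sum_(J <- lst | size J == k) edge_term n m adj g J.

Record start s := Start {
  start_n : s aIN 0 = n%:R;
  start_m : s aIN 1 = m%:R;
  start_adj : forall u v, (v < u < n)%N -> s aADJ (u * n + v)%N = (adj u v)%:R;
  start_0 : forall y k, (2 <= y)%N -> s y k = 0 }.

Lemma m1_neq0 : m%:R - 1 != 0 :> rat.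
Proof. by rewrite subr_eq0 (eqr_nat _ m 1) gtn_eqF. Qed.

Lemma init_ok s : start s ->
  runs s (prog_init gq) (fun s' =>
    [/\ env n m K adj g s', s' aDEG 0 = 0, s' aNUM 0 = 0 & forall k, s' aMARK k = 0]).
Proof.
move=> st.
have [hn hm hadj h0] := st.
apply: (runs_seq Z_large); apply: (runs_set Z_large (v := g)) => //.
  apply: eval_div; first exact: eval_cst.
  - apply: eval_sub; [exact: eval_m hm|exact: eval_nat|by []].
  - exact: m1_neq0.
  - by [].
apply: (runs_seq Z_large); apply: (runs_set Z_large (v := 1)) => //.
  exact: eval_nat.
pose d i := minn i (up_log 2 m).
pose Inv i s' := [/\ (forall y k, y \notin [:: vG; vQ; vJ; vK] -> s' y k = s y k),
  s' vG 0 = g, s' vQ 0 = (2 ^ d i)%N%:R & s' vK 0 = (156 * d i)%N%:R].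
apply: (runs_for Z_large (Inv := Inv) (N := m)) => //.
- exact: leq_trans mn nZ.
- split; rewrite /d ?min0n //; last by rewrite muln0 /update /= h0.
  by move=> y k; rewrite !inE !negb_or /update => /and4P[]; do 4!case: eqP => //.
- by move=> i s' _ [h _ _ _] _; apply: eval_m; rewrite h.
- move=> i s' im [h hg hq hk] hi.
  have hm' : s' aIN 1 = m%:R by rewrite h.
  apply: (runs_if Z_large (v := ((2 ^ d i)%N%:R < m%:R :> rat)%R%:R)) => //.
    by apply: eval_lt; [exact: eval_var|exact: eval_m hm'].
  (* The number of doublings done after [i] rounds is [minn i (up_log 2 m)]. *)
  have bound : (2 ^ d i < m)%N = (i < up_log 2 m)%N.
    have [il|li] := ltnP i (up_log 2 m).
      rewrite /d (minn_idPl (ltnW il)) ltnNge; apply/negP => /(@up_log_min 2 _ _ isT).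
      by rewrite leqNgt il.
    by rewrite /d (minn_idPr li) ltnNge up_logP.
  rewrite ltr_nat bound; case: ltnP => il; rewrite ?oner_eq0 ?eqxx /=; last first.
    apply: (runs_skip Z_large); split=> //.
    have dS : d i.+1 = d i by rewrite /d !(minn_idPr _) // ltnW.
    split; rewrite ?dS /update //=.
    move=> y k yn; rewrite -h //; move: yn; rewrite !inE !negb_or /update.
    by move=> /and4P[_ _ /negPf -> _].
  have dS : d i.+1 = (d i).+1 by rewrite /d (minn_idPl il) (minn_idPl (ltnW il)).
  apply: (runs_seq Z_large); apply: (runs_set Z_large (v := (2 ^ d i.+1)%N%:R)) => //.
    apply: eval_add; try (apply: eval_var; exact: hq).
    by rewrite -natrD dS expnS mul2n addnn.
  apply: (runs_set Z_large (v := (156 * d i.+1)%N%:R)) => //.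
    apply: eval_add; [by apply: eval_var; exact: hk|exact: eval_nat|].
    by rewrite -natrD dS mulnSr.
  split=> //; split=> //.
  move=> y k yn; rewrite -h //; move: yn; rewrite !inE !negb_or /update.
  by move=> /and4P[_ /negPf -> /negPf -> /negPf ->].
move=> s' [h hg hq hk].
have dm : d m = up_log 2 m.
  by apply/minn_idPr/up_log_min => //; rewrite ltnW // ltn_expl.
have z y k : (2 <= y)%N -> y \notin [:: vG; vQ; vJ; vK] -> s' y k = 0.
  by move=> y2 yn; rewrite h // h0.
split; try by move=> *; apply: z.
split; try by move=> *; apply: z.
- by rewrite h.
- by rewrite h.
- by move=> u v uv; rewrite h // hadj.
- by rewrite hk dm.
- exact: hg.
Qed.

Lemma collect_ok s : (size lst <= Z)%N -> list_state n m K adj g lst s ->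
  runs s prog_collect (fun s' =>
    (forall y k, y \notin [:: vI; aCOEF] -> s' y k = s y k)
    /\ forall k, s' aCOEF k = coef k).
Proof.
move=> LZ [es hL hl _].
pose Inv i s' := (forall y k, y \notin [:: vI; aCOEF] -> s' y k = s y k)
    /\ forall k, s' aCOEF k = \sum_(J <- take i lst | size J == k) edge_term n m adj g J.
apply: (runs_for Z_large (Inv := Inv) (N := size lst)) => //.
- split; last by move=> k; rewrite take0 big_nil /update /= (env_coef es).
  by move=> y k; rewrite !inE !negb_or /update => /andP[/negPf -> _].
- by move=> i s' _ [h _] _; apply: eval_var; rewrite h.
- move=> i s' il [h hc] hi; have [[h1 h2 h3] h4] := hl i il.
  set J := nth _ _ _ in h1 h2 h3 h4.
  have eD : eval s' (Read aDEG (Var vI)) (size J)%:R.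
    by apply: eval_cell (eval_var hi) _; rewrite h.
  apply: (runs_write Z_large (k := size J)
    (v := \sum_(J <- take i.+1 lst | size J == size (nth [::] lst i)) edge_term n m adj g J)) => //.
    apply: eval_add; first exact: (eval_cell eD (hc _)).
      by apply: eval_cell (eval_var hi) _; rewrite h // h2.
    by rewrite (take_nth [::] il) -/J big_rcons /= eqxx /= h2.
  split=> //; split.
    move=> y k yn; rewrite -h //; move: yn; rewrite !inE !negb_or /update.
    by move=> /andP[/negPf -> /negPf ->].
  move=> k; rewrite /update /=; case: eqP => [->//|/eqP kJ].
  by rewrite hc (take_nth [::] il) -/J big_rcons /= [size J == k]eq_sym (negPf kJ) addr0.
- by move=> s' [h hc]; split=> // k; rewrite hc take_size.
Qed.

Lemma log_ok s : (K <= Z)%N -> s vK 0 = K%:R -> s vY 0 = 0 ->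
  (forall k, s aCOEF k = coef k) ->
  runs s prog_log (fun s' =>
    (forall y k, y \notin [:: vI; vJ; vS; aLOG; vY] -> s' y k = s y k)
    /\ exists l, log_coefs coef l K /\ s' vY 0 = \sum_(k < K) l k.+1).
Proof.
move=> KZ hK hY hC.
pose Inv i s' := [/\
  (forall y k, y \notin [:: vI; vJ; vS; aLOG; vY] -> s' y k = s y k),
  log_coefs coef (s' aLOG) i & s' vY 0 = \sum_(k < i) s' aLOG k.+1].
apply: (runs_for Z_large (Inv := Inv) (N := K)) => //.
- split=> //; last by rewrite big_ord0 /update.
  by move=> y k; rewrite !inE !negb_or /update => /andP[/negPf -> _].
- by move=> i s' _ [h _ _] _; apply: eval_var; rewrite h.
- move=> i s' iK [h hl hy] hi.
  apply: (runs_seq Z_large); apply: (runs_set Z_large (v := 0)) => //.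
    exact: eval_nat.
  apply: (runs_seq Z_large).
  pose Inv2 j s2 := [/\ (forall y k, y \notin [:: vJ; vS] -> s2 y k = s' y k) &
    s2 vS 0 = \sum_(k < j) k.+1%:R * s' aLOG k.+1 * coef (i - k)%N].
  apply: (runs_for Z_large (Inv := Inv2) (N := i)) => //.
  + exact: ltnW (leq_trans iK KZ).
  + split; last by rewrite big_ord0 /update.
    by move=> y k; rewrite !inE !negb_or /update => /andP[/negPf -> /negPf ->].
  + by move=> j s2 _ [h2 _] _; apply: eval_var; rewrite h2.
  + move=> j s2 ji [h2 hS] hj.
    have eS : eval s2 (Op OpAdd (Var vJ) (Nat 1)) j.+1%:R.
      by apply: eval_add (eval_var hj) (eval_nat _ _) _; rewrite natr1.
    apply: (runs_set Z_large
      (v := \sum_(k < j.+1) k.+1%:R * s' aLOG k.+1 * coef (i - k)%N)) => //.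
      apply: eval_add; first exact: eval_var hS.
        apply: eval_mul; first (apply: eval_mul; first exact: eS).
        * by apply: eval_cell eS _; apply: h2.
        * by [].
        * apply: (eval_cell (k := (i - j)%N) (v := coef (i - j)%N)).
            apply: eval_sub (eval_var _) (eval_var hj) _.
              by rewrite h2 //; exact: hi.
            by rewrite hi natrB ?(ltnW ji).
          by rewrite h2 // h // hC.
        * by [].
      by rewrite big_ord_recr.
    split; first by rewrite /update.
    split=> // y k yn; rewrite -h2 //; move: yn; rewrite !inE !negb_or /update.
    by move=> /andP[/negPf -> /negPf ->].
  + move=> s2 [h2 hS].
    have hi2 : s2 vI 0 = i%:R by rewrite h2.
    have eS s3 : s3 vI 0 = i%:R -> eval s3 (Op OpAdd (Var vI) (Nat 1)) i.+1%:R.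
      by move=> h3; apply: eval_add (eval_var h3) (eval_nat _ _) _; rewrite natr1.
    set v := coef i.+1 - (\sum_(j < i) j.+1%:R * s' aLOG j.+1 * coef (i - j)%N) / i.+1%:R.
    apply: (runs_seq Z_large); apply: (runs_write Z_large (k := i.+1) (v := v)) => //.
    * exact: eS.
    * apply: (eval_sub (a := coef i.+1)).
        by apply: eval_cell (eS _ hi2) _; rewrite h2 // h // hC.
        apply: eval_div; [exact: eval_var hS|exact: eS|by rewrite pnatr_eq0|by []].
      by [].
    apply: (runs_set Z_large (v := \sum_(k < i) s' aLOG k.+1 + v)) => //.
      apply: (eval_add (a := \sum_(k < i) s' aLOG k.+1) (b := v)).
        by apply: eval_var; rewrite -hy; apply: (h2 vY 0 isT).
        apply: (eval_cell (k := i.+1)); first by apply: eS; exact: hi2.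
        by rewrite /update /= eqxx.
      by [].
    set s4 := update _ _ _ _.
    have L4 k : (k <= i)%N -> update s4 vI 0 i.+1%:R aLOG k = s' aLOG k.
      by move=> ki; rewrite /s4 /update /=; case: eqP => [e|_]; [lia|rewrite h2].
    have L4' : update s4 vI 0 i.+1%:R aLOG i.+1 = v by rewrite /s4 /update /= eqxx.
    split; first exact: hi2.
    split.
    * move=> y k yn; rewrite -h // -h2; last first.
        by move: yn; rewrite !inE !negb_or => /and5P[_ -> -> _ _].
      move: yn; rewrite !inE !negb_or /s4 /update.
      by move=> /and5P[/negPf -> _ _ /negPf -> /negPf ->].
    * move=> k; rewrite ltnS => ki.
      rewrite (eq_bigr (fun j : 'I_k => j.+1%:R * s' aLOG j.+1 * coef (k - j)%N)); last first.
        by move=> j _; rewrite L4 // (leq_trans (ltn_ord j)).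
      move: ki; rewrite leq_eqVlt => /predU1P[->|ki]; first by rewrite L4'.
      by rewrite L4 // hl.
    * rewrite big_ord_recr /= L4'.
      rewrite [in RHS](eq_bigr (fun j : 'I_i => s' aLOG j.+1)) // => j _.
      by rewrite L4.
- by move=> s' [h hl hy]; split=> //; exists (s' aLOG).
Qed.

Definition out_value (Y : rat) : rat :=
  (1 + (Y + gq * m%:R) / (exp_steps m K)%:R) ^+ exp_steps m K
  * (\prod_(i < m) ((n%:R - i%:R) / i.+1%:R))
  * (1 + g)^-1 ^+ 'C(m, 2).

Lemma g_gt0 : 0 < g.
Proof. by rewrite divr_gt0 // subr_gt0 (ltr_nat _ 1 m). Qed.

Lemma output_ok s Y : (exp_steps m K <= Z)%N -> s aIN 0 = n%:R -> s aIN 1 = m%:R ->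
  s vK 0 = K%:R -> s vG 0 = g -> s vY 0 = Y ->
  runs s (prog_output gq) (fun s' => s' aOUT 0 = out_value Y).
Proof.
move=> MZ hn hm hK hg hY.
have mZ : (m <= Z)%N := leq_trans mn nZ.
pose M := exp_steps m K; pose q := 1 + (Y + gq * m%:R) / M%:R.
have M0 : (M%:R : rat) != 0.
  by rewrite pnatr_eq0 /M /exp_steps -lt0n !muln_gt0 /= (ltnW m_gt1).
apply: (runs_seq Z_large); apply: (runs_set Z_large (v := Y + gq * m%:R)) => //.
  apply: eval_add; [exact: eval_var hY| |by []].
  by apply: eval_mul; [exact: eval_cst|exact: eval_m hm|].
apply: (runs_seq Z_large); apply: (runs_set Z_large (v := (m * m * K.+1)%N%:R)) => //.
  apply: (eval_mul (a := (m * m)%N%:R) (b := K.+1%:R)).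
  - by apply: eval_mul; [exact: eval_m hm|exact: eval_m hm|rewrite natrM].
  - by apply: eval_add; [apply: eval_var; exact: hK|exact: eval_nat|rewrite natr1].
  - by rewrite -natrM.
apply: (runs_seq Z_large); apply: (runs_set Z_large (v := M%:R)) => //.
  apply: (eval_mul (a := (100 * (m * m * K.+1))%N%:R) (b := (m * m * K.+1)%N%:R)).
  - apply: eval_mul; [exact: eval_nat|exact: eval_var|by rewrite -natrM].
  - exact: eval_var.
  - by rewrite -natrM.
apply: (runs_seq Z_large); apply: (runs_set Z_large (v := q)) => //.
  apply: eval_add; [exact: eval_nat| |by []].
  by apply: eval_div; [exact: eval_var|exact: eval_var|exact: M0|].
apply: (runs_seq Z_large); apply: (runs_set Z_large (v := 1)) => //.
  exact: eval_nat.
set s0 := update _ _ _ _.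
pose A1 i := q ^+ i.
pose A2 i := A1 M * \prod_(j < i) ((n%:R - j%:R) / j.+1%:R).
pose A3 i := A2 m * (1 + g)^-1 ^+ 'C(i, 2).
pose keep s' := forall y k, y \notin [:: vI; vJ; vA] -> s' y k = s0 y k.
have keep_upd s' x v : x \in [:: vI; vJ; vA] -> keep s' -> keep (update s' x 0 v).
  move=> xc kp y k yn; rewrite -kp // /update; case: eqP => // yx.
  by rewrite yx xc in yn.
have keep0 : keep s0 by [].
apply: (runs_seq Z_large).
apply: (runs_for Z_large (N := M)
  (Inv := fun i s' => keep s' /\ s' vA 0 = A1 i)) => //.
- by split; [exact: keep_upd|rewrite /A1 expr0].
- by move=> i s' _ [kp _] _; apply: eval_var; rewrite kp.
- move=> i s' _ [kp hA] hi; apply: (runs_set Z_large (v := A1 i.+1)) => //.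
    apply: eval_mul; [exact: eval_var hA|by apply: (eval_var (v := q)); rewrite kp|].
    by rewrite /A1 exprSr.
  by split=> //; split=> //; do 2!apply: (keep_upd) => //.
move=> s1 [kp1 hA1]; apply: (runs_seq Z_large).
apply: (runs_for Z_large (N := m)
  (Inv := fun i s' => keep s' /\ s' vA 0 = A2 i)) => //.
- by split; [exact: keep_upd|rewrite /A2 big_ord0 mulr1].
- by move=> i s' _ [kp _] _; apply: eval_m; rewrite kp.
- move=> i s' _ [kp hA] hi; apply: (runs_set Z_large (v := A2 i.+1)) => //.
    apply: eval_mul; first exact: eval_var hA.
      apply: eval_div.
      + apply: eval_sub; [by apply: (eval_n (n := n)); rewrite kp|exact: eval_var hi|by []].
      + by apply: (eval_add (c := i.+1%:R)); [exact: eval_var hi|exact: eval_nat|rewrite natr1].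
      + by rewrite pnatr_eq0.
      + by [].
    by rewrite /A2 big_ord_recr /= [RHS]mulrA.
  by split=> //; split=> //; do 2!apply: (keep_upd) => //.
move=> s2 [kp2 hA2]; apply: (runs_seq Z_large).
apply: (runs_for Z_large (N := m)
  (Inv := fun i s' => keep s' /\ s' vA 0 = A3 i)) => //.
- by split; [exact: keep_upd|rewrite /A3 bin0n expr0 mulr1].
- by move=> i s' _ [kp _] _; apply: eval_m; rewrite kp.
- move=> i s' im [kp hA] hi.
  apply: (runs_for Z_large (N := i) (Inv := fun j s3 =>
     [/\ keep s3, s3 vI 0 = i%:R & s3 vA 0 = A3 i * (1 + g)^-1 ^+ j])) => //.
  + exact: ltnW (leq_trans im mZ).
  + by split; [exact: keep_upd| |rewrite expr0 mulr1].
  + by move=> j s3 _ [_ h _] _; apply: eval_var.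
  + move=> j s3 ji [kp3 hi3 hA3] hj.
    apply: (runs_set Z_large (v := A3 i * (1 + g)^-1 ^+ j.+1)) => //.
      apply: eval_div; first exact: eval_var hA3.
      * apply: (eval_add (c := 1 + g)); first exact: eval_nat.
          by apply: (eval_var (v := g)); rewrite kp3.
        by [].
      * by rewrite gt_eqF // addr_gt0 // g_gt0.
      * by rewrite exprSr mulrA.
    by split=> //; split=> //; do 2!apply: (keep_upd) => //.
  + move=> s3 [kp3 hi3 hA3]; split=> //; split; first exact: keep_upd.
    by rewrite {1}/update /= hA3 /A3 binS bin1 exprD mulrA.
move=> s3 [kp3 hA3].
by apply: (runs_set Z_large (v := A3 m)) => //; exact: eval_var hA3.
Qed.

Theorem density_prog_ok s : (size lst <= Z)%N -> (K <= Z)%N ->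
  (exp_steps m K <= Z)%N -> start s ->
  runs s (density_prog gq) (fun s' => exists l,
    log_coefs coef l K /\ s' aOUT 0 = out_value (\sum_(k < K) l k.+1)).
Proof.
move=> LZ KZ MZ st.
apply: (runs_seq Z_large); apply: runs_mono (init_ok st) => s1 [e1 d1 n1 m1].
apply: (runs_seq Z_large).
apply: runs_mono (edge_sets_ok Z_large nZ LZ e1 d1 n1 m1) => s2 r2.
apply: (runs_seq Z_large); apply: runs_mono (collect_ok LZ r2) => s3 [k3 c3].
have [[hn hm _ hK hg _ hY] _ _ _] := r2.
apply: (runs_seq Z_large).
apply: runs_mono (log_ok KZ _ _ c3); rewrite ?k3 // => s4 [k4 [l [hl hy]]].
apply: runs_mono (output_ok MZ _ _ _ _ hy); rewrite ?k4 ?k3 // => s5 h5.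
by exists l.
Qed.

End Program.

(** * Coefficients of the graph polynomial *)

Section EdgeSetsCoef.
Variables (F : comNzRingType) (K : nat).

(** Multiplying by [1 + b p 'X] corresponds to one round of [add_edge]; sets
    with more than [K] elements do not affect the coefficients up to [K]. *)
Lemma edge_sets_coef (b : nat * nat -> F) ps k : (k <= K)%N ->
  (\prod_(p <- ps) (1%:P + b p *: 'X))`_k
  = \sum_(J <- edge_sets K ps | size J == k) \prod_(p <- J) b p.
Proof.
elim/last_ind: ps k => [|ps p IH] k kK.
  rewrite big_nil /edge_sets /= big_cons big_nil big_nil coef1 eq_sym.
  by case: eqP; rewrite ?addr0.
rewrite big_rcons /= mulrDr mulr1 -scalerAr coefD coefZ coefMX.
rewrite -cats1 edge_sets_cat /= /add_edge big_cat /= -IH //; congr (_ + _).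
rewrite big_map big_filter_cond.
case: k kK => [|k] kK /=.
  by rewrite mulr0 big1 // => J /andP[_ /eqP].
rewrite IH ?(ltnW kK) // mulr_sumr; apply: eq_big => [J|J _]; last by rewrite big_cons.
by rewrite eqSS; case: eqP => [->|]; rewrite ?kK ?andbF.
Qed.

Lemma edge_sets_below n ps : all (fun p => (p.1 < n)%N && (p.2 < n)%N) ps ->
  all (fun J => below n (touched J)) (edge_sets K ps).
Proof.
elim/last_ind: ps => [|ps p IH] //; rewrite all_rcons => /andP[/andP[p1 p2] /IH h].
rewrite -cats1 edge_sets_cat /= /add_edge all_cat h /= all_map.
apply/allP => J; rewrite mem_filter => /andP[_ /(allP h) bJ] /=.
by rewrite !below_touch.
Qed.

End EdgeSetsCoef.

Lemma mem_pairs n p : (p \in pairs n) = (p.2 < p.1 < n)%N.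
Proof.
case: p => u v /=; apply/flatten_mapP/idP => [[u'] | /andP[vu un]].
  by rewrite mem_iota => un /mapP[v']; rewrite mem_iota => vu [-> ->]; lia.
by exists u; rewrite ?mem_iota //; apply/mapP; exists v; rewrite ?mem_iota.
Qed.

Lemma uniq_pairs n : uniq (pairs n).
Proof.
rewrite /pairs; elim: n => [|n IH] //.
rewrite -addn1 iotaD add0n map_cat flatten_cat cat_uniq IH /= cats0.
rewrite map_inj_uniq ?iota_uniq; last by move=> v v' [].
rewrite andbT; apply/hasPn => p /mapP[v]; rewrite mem_iota => vn ->.
apply/negP => /flatten_mapP[u]; rewrite mem_iota => un /mapP[v' _ [E]].
by move: un; rewrite -E ltnn andbF.
Qed.

Lemma bin_contain_prob (F : numFieldType) n m k : (m <= n)%N -> (k <= m)%N ->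
  'C(n - k, m - k)%:R = 'C(n, m)%:R * contain_prob F n m k.
Proof.
move=> mn; elim: k => [|k IH] km; first by rewrite !subn0 /contain_prob big_ord0 mulr1.
have -> : contain_prob F n m k.+1 = contain_prob F n m k * ((m%:R - k%:R) / (n%:R - k%:R)).
  by rewrite /contain_prob big_ord_recr.
rewrite [RHS]mulrA -IH ?(ltnW km) //.
have kn : (k < n)%N := leq_trans km mn.
rewrite -!natrB ?(ltnW km) ?(ltnW kn) //.
have nk0 : ((n - k)%:R : F) != 0 by rewrite pnatr_eq0 -lt0n subn_gt0.
apply: (mulfI nk0); rewrite [RHS]mulrCA [X in _ = _ * X]mulrC divfK // -!natrM.
have -> : (n - k.+1 = (n - k).-1)%N by lia.
have -> : (m - k.+1 = (m - k).-1)%N by lia.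
have E := mul_bin_diag (n - k) (m - k).-1.
have E2 : ((m - k).-1.+1 = m - k)%N by lia.
rewrite E2 in E.
by rewrite E mulnC.
Qed.

Lemma contain_prob_large (F : numFieldType) n m k : (m < k)%N -> contain_prob F n m k = 0.
Proof. by move=> mk; rewrite /contain_prob (bigD1 (Ordinal mk)) //= subrr mul0r mul0r. Qed.

Lemma bin_prod (F : numFieldType) n m : (m <= n)%N ->
  \prod_(i < m) ((n%:R - i%:R) / i.+1%:R) = 'C(n, m)%:R :> F.
Proof.
elim: m => [|m IH] mn; first by rewrite big_ord0 bin0.
rewrite big_ord_recr /= IH ?(ltnW mn) // -natrB ?(ltnW mn) //.
rewrite mulrA -natrM mulnC -mul_bin_left natrM mulrC mulKf // pnatr_eq0 //.
Qed.

Section Supersets.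
Variable V : finType.
Implicit Types (U S : {set V}).

Lemma card_supersets U m : (#|U| <= m)%N ->
  #|[set S : {set V} | (#|S| == m) && (U \subset S)]| = 'C(#|V| - #|U|, m - #|U|).
Proof.
move=> Um; have -> : (#|V| - #|U| = #|~: U|)%N by rewrite [in RHS]cardsCs setCK.
rewrite -cards_draws.
have inj : {in [set S : {set V} | (#|S| == m) && (U \subset S)] &,
   injective (fun S => S :\: U)}.
  move=> S S'; rewrite !inE => /andP[_ US] /andP[_ US'] E.
  by rewrite -(setID S U) -(setID S' U) E (setIidPr US) (setIidPr US').
rewrite -(card_in_imset inj); apply: eq_card => T; rewrite inE.
apply/imsetP/andP => [[S]|[TU /eqP Tm]].
  rewrite inE => /andP[/eqP Sm US] ->; split; first by rewrite setDE subsetIr.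
  by rewrite cardsD (setIidPr US) Sm.
have UT : U :&: T = finset.set0.
  by apply/eqP; rewrite setI_eq0 disjoint_sym disjoints_subset.
exists (U :|: T); last first.
  by rewrite setDUl setDv set0U; apply/esym/setDidPl; rewrite disjoints_subset.
by rewrite inE subsetUl cardsU UT cards0 subn0 Tm subnKC ?eqxx.
Qed.

(** The number of [m]-sets times the probability that a random one contains
    [U]; both sides vanish when [U] has more than [m] elements. *)
Lemma sum_supersets (F : numFieldType) U m : (m <= #|V|)%N ->
  \sum_(S : {set V} | (#|S| == m) && (U \subset S)) 1
  = 'C(#|V|, m)%:R * contain_prob F #|V| m #|U|.
Proof.
move=> mV; have [Um|mU] := leqP #|U| m.
  by rewrite -bin_contain_prob // -card_supersets // sumr_const cardsE.
rewrite contain_prob_large // mulr0 big1 // => S /andP[/eqP Sm /subset_leq_card].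
by rewrite Sm leqNgt mU.
Qed.

End Supersets.

Section GraphPolynomial.
Variables (R : realType) (V : finType) (G : sgraph V) (m : nat) (x0 : V).
Hypothesis mV : (m <= #|V|)%N.
Implicit Types (e S U : {set V}) (g : R).
Local Notation n := #|V|.

Definition vertex (u : nat) : V := nth x0 (enum V) u.
Definition adjacent u v := [set vertex u; vertex v] \in edges G.

Lemma vertexK u : (u < n)%N -> enum_rank (vertex u) = u :> nat.
Proof.
move=> un; rewrite /vertex -(@enum_val_nth V V x0 (Ordinal un)) enum_valK.
by [].
Qed.

Lemma vertex_inj u v : (u < n)%N -> (v < n)%N -> vertex u = vertex v -> u = v.
Proof. by move=> un vn E; rewrite -(vertexK un) E vertexK. Qed.

Lemma rankK (x : V) : vertex (enum_rank x) = x.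
Proof. by rewrite /vertex nth_enum_rank. Qed.

(** The 2-subsets of [S] are the images of the index pairs with both ends in
    [S]. *)
Lemma big_pairs (F : comNzRingType) (f : {set V} -> F) S :
  \prod_(e : {set V} | (#|e| == 2) && (e \subset S)) f e
  = \prod_(p <- pairs n | (vertex p.1 \in S) && (vertex p.2 \in S))
      f [set vertex p.1; vertex p.2].
Proof.
pose h p := [set vertex p.1; vertex p.2].
have inj : {in pairs n &, injective h}.
  move=> [u v] [u' v']; rewrite !mem_pairs /= => /andP[vu un] /andP[vu' un'] E.
  have vn := ltn_trans vu un; have vn' := ltn_trans vu' un'.
  have iff a b c : (a < n)%N -> (b < n)%N -> (c < n)%N ->
      vertex a \in h (b, c) -> (a == b) || (a == c).
    move=> an bn cn; rewrite !inE /=.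
    by case/orP => /eqP/vertex_inj -> //; rewrite eqxx ?orbT.
  have : (u == u') || (u == v') by apply: iff => //; rewrite -E !inE eqxx.
  have : (v == u') || (v == v') by apply: iff => //; rewrite -E !inE eqxx orbT.
  have : (u' == u) || (u' == v) by apply: iff => //; rewrite E !inE eqxx.
  by move=> h1 h2 h3; congr pair; lia.
have uniq_h : uniq (map h (pairs n)) by rewrite map_inj_in_uniq // uniq_pairs.
transitivity (\prod_(e <- map h (pairs n) | e \subset S) f e).
  rewrite -[LHS]big_filter -[RHS]big_filter.
  apply: perm_big; apply: uniq_perm.
  - exact/filter_uniq/index_enum_uniq.
  - exact: filter_uniq.
  move=> e; rewrite !mem_filter mem_index_enum andbT andbC; congr (_ && _).
  apply/idP/mapP => [/cards2P[x [y [xy ->]]]|[p]]; last first.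
    rewrite mem_pairs => /andP[vu un] ->; rewrite cards2 (_ : _ != _) //.
    apply/eqP => /(vertex_inj un (ltn_trans vu un)) E.
    by rewrite E ltnn in vu.
  wlog lt : x y xy / (enum_rank y < enum_rank x)%N.
    move=> W; case: (ltngtP (enum_rank x) (enum_rank y)) => [l|l|/val_inj/enum_rank_inj E].
    - by rewrite setUC; apply: W => //; rewrite eq_sym.
    - exact: W.
    - by rewrite E eqxx in xy.
  exists (nat_of_ord (enum_rank x), nat_of_ord (enum_rank y)).
    by rewrite mem_pairs /= lt ltn_ord.
  by rewrite /h /= !rankK.
by rewrite big_map; apply: eq_bigl => p; rewrite subUset !sub1set.
Qed.

(** [g] on edges and [- g] elsewhere. *)
Definition edge_sign g e : R := g * (2 * (e \in edges G)%:R - 1).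
(** The polynomial that interpolates between the complete graph with all
    weights 1, at 0, and the given graph, at 1. *)
Definition density_poly g : {poly R} := segment_poly m (fun=> 1) (edge_sign g) finset.set0.

(** A set [S] contributes when it contains all edges of [J], that is, all
    vertices that they touch. *)
Lemma sum_edge_terms g J : below n (touched J) ->
  \sum_(S : {set V} | #|S| == m)
     \prod_(p <- J) (if (vertex p.1 \in S) && (vertex p.2 \in S)
                     then edge_sign g [set vertex p.1; vertex p.2] else 0)
  = 'C(n, m)%:R * edge_term n m adjacent g J.
Proof.
move=> bJ; pose U := [set x in map vertex (touched J)].
have memU p S : p \in J -> U \subset S -> (vertex p.1 \in S) && (vertex p.2 \in S).
  move=> pJ /subsetP US.
  suff : (p.1 \in touched J) && (p.2 \in touched J).
    by case/andP => h1 h2; rewrite !US // inE map_f.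
  elim: (J) pJ => //= q J' IH; rewrite inE !mem_touch => /predU1P[->|/IH /andP[-> ->]].
    by rewrite !eqxx !orbT.
  by rewrite !orbT.
have Umem S : ~~ (U \subset S) ->
   has (fun p => ~~ ((vertex p.1 \in S) && (vertex p.2 \in S))) J.
  apply: contraR => /hasPn h; apply/subsetP => x; rewrite inE => /mapP[w wJ ->].
  elim: (J) wJ h => //= q J' IH; rewrite !mem_touch => wq h.
  have := h q (mem_head _ _); rewrite negbK => /andP[q1 q2].
  case/or3P: wq => [/eqP ->|/eqP ->|wJ] //.
  by apply: IH => // p pJ; apply: h; rewrite inE pJ orbT.
have cardU : #|U| = size (touched J).
  rewrite cardsE; have /card_uniqP -> : uniq (map vertex (touched J)).
    rewrite map_inj_in_uniq ?uniq_touched // => u v uJ vJ.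
    by apply: vertex_inj; [exact: (allP bJ)|exact: (allP bJ)].
  by rewrite size_map.
rewrite (bigID (fun S : {set V} => U \subset S)) /= [X in _ + X]big1 ?addr0; last first.
  move=> S /andP[_ /Umem /hasP[p pJ pS]].
  by rewrite (big_rem p pJ) /= (negPf pS) mul0r.
rewrite (eq_bigr (fun=> \prod_(p <- J) sgn_adj adjacent g p * 1)); last first.
  move=> S /andP[_ US]; rewrite mulr1 big_seq [RHS]big_seq; apply: eq_bigr => p pJ.
  by rewrite (memU p S pJ US).
by rewrite -mulr_sumr sum_supersets // cardU /edge_term mulrCA mulrA.
Qed.

(** Only sets of [k] pairs matter for coefficient [k], and the sets [S] enter
    through their number alone. Hence the coefficient is computable in time
    n^O(k). *)
Lemma coef_density_poly g K k : (k <= K)%N ->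
  (density_poly g)`_k
  = 'C(n, m)%:R * \sum_(J <- edge_sets K (pairs n) | size J == k) edge_term n m adjacent g J.
Proof.
move=> kK; rewrite /density_poly /segment_poly /clique_sum coef_sum.
transitivity (\sum_(S : {set V} | #|S| == m)
  \sum_(J <- edge_sets K (pairs n) | size J == k)
     \prod_(p <- J) (if (vertex p.1 \in S) && (vertex p.2 \in S)
                     then edge_sign g [set vertex p.1; vertex p.2] else 0)).
  apply: eq_big => [S|S _]; first by rewrite finset.sub0set andbT.
  rewrite -(edge_sets_coef _ _ kK) /clique_prod big_pairs.
  apply: (congr1 (fun p : {poly R} => p`_k)); rewrite big_mkcond.
  by apply: eq_bigr => p _; case: ifP => // _; rewrite scale0r addr0.
rewrite exchange_big mulr_sumr /= big_seq_cond [RHS]big_seq_cond.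
apply: eq_bigr => J /andP[Jin _]; apply: sum_edge_terms.
have /allP -> // : all (fun J => below n (touched J)) (edge_sets K (pairs n)).
apply: edge_sets_below; apply/allP => p; rewrite mem_pairs => /andP[vu un].
by rewrite un (ltn_trans vu).
Qed.

End GraphPolynomial.

(** * Weights as values of the graph polynomial *)

Section Weights.
Variables (R : realType) (V : finType) (G : sgraph V) (m : nat).
Hypothesis (m_gt1 : (1 < m)%N).
Implicit Types (e S U : {set V}) (g gamma : R).
Local Notation N := 'C(m, 2).

Definition edges_in S := [set e in edges G | e \subset S].

Lemma card_pairs_in S : #|S| = m -> #|[set e : {set V} | (e \subset S) && (#|e| == 2)]| = N.
Proof. by move=> Sm; rewrite cards_draws Sm. Qed.

Lemma card_edges_in S : #|S| = m -> (#|edges_in S| <= N)%N.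
Proof.
move=> Sm; rewrite -(card_pairs_in Sm) subset_leq_card //.
by apply/subsetP => e; rewrite !inE => /andP[/edges_card2 -> ->].
Qed.

Lemma clique_prod_sign g S : #|S| = m ->
  clique_prod (fun e => 1 + edge_sign G g e) S
  = (1 + g) ^+ #|edges_in S| * (1 - g) ^+ (N - #|edges_in S|).
Proof.
move=> Sm; rewrite /clique_prod (bigID (mem (edges G))) /=; congr (_ * _).
  rewrite (eq_bigr (fun=> 1 + g)); last first.
    by move=> e /andP[_ eG]; rewrite /edge_sign eG /=; ring.
  rewrite prodr_const; congr (_ ^+ _); apply: eq_card => e; rewrite !inE.
  rewrite -topredE /= andbC; case eG : (e \in edges G) => //=.
  by rewrite (edges_card2 eG).
rewrite (eq_bigr (fun=> 1 - g)); last first.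
  by move=> e /andP[_ /negPf eG]; rewrite /edge_sign eG /=; ring.
rewrite prodr_const; congr (_ ^+ _).
have -> : (N - #|edges_in S|)%N
   = #|[set e : {set V} | (e \subset S) && (#|e| == 2)] :\: edges_in S|.
  rewrite cardsD card_pairs_in // (setIidPr _) //.
  by apply/subsetP => e; rewrite !inE => /andP[/edges_card2 -> ->].
apply: eq_card => e; rewrite !inE -topredE /=.
by case: (e \in edges G); case: (e \subset S); case: (_ == _).
Qed.

(** With [k] edges inside [S], the two powers in the weight have exponents
    [k - N] and [N - k]; moving the factor [(1 + g) ^+ N] out leaves a product
    over all pairs. *)
Lemma weightE gamma S (g := gamma / (m%:R - 1)) : 0 < g < 1 -> #|S| = m ->
  weight G gamma m S
  = expR (gamma * m%:R) * (1 + g)^-1 ^+ N * clique_prod (fun e => 1 + edge_sign G g e) S.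
Proof.
move=> /andP[g0 g1] Sm; rewrite clique_prod_sign // /weight -/g.
have N0 : (N%:R : R) != 0 by rewrite pnatr_eq0 -lt0n bin_gt0.
have -> : density R G S = #|edges_in S|%:R / N%:R by rewrite /density Sm.
set k := #|edges_in S|; have kN : (k <= N)%N := card_edges_in Sm.
have -> : (k%:R / N%:R - 1) * N%:R = - (N - k)%:R :> R.
  by rewrite mulrBl divfK // mul1r natrB // opprB.
have -> : (1 - k%:R / N%:R) * N%:R = (N - k)%:R :> R.
  by rewrite mulrBl divfK // mul1r natrB.
have p1 : 0 < 1 + g by rewrite addr_gt0.
have p2 : 0 <= 1 - g by rewrite subr_ge0 ltW.
rewrite powRN !powR_mulrn ?(ltW p1) //.
rewrite -[LHS]mulrA -[RHS]mulrA; congr (_ * _); rewrite [RHS]mulrA; congr (_ * _).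
rewrite -{2}(subnK kN) exprD -mulrA -exprMn mulVf ?gt_eqF // expr1n mulr1.
by rewrite exprVn.
Qed.

Lemma horner1_density_poly g :
  (density_poly G m g).[1]
  = \sum_(S : {set V} | #|S| == m) clique_prod (fun e => 1 + edge_sign G g e) S.
Proof.
rewrite horner_segment_poly /clique_sum; apply: eq_big => [S|S _].
  by rewrite finset.sub0set andbT.
by apply: eq_bigr => e _; rewrite mul1r.
Qed.

Lemma DensityE gamma (g := gamma / (m%:R - 1)) : 0 < g < 1 ->
  Density G gamma m
  = expR (gamma * m%:R) * (1 + g)^-1 ^+ N * (density_poly G m g).[1].
Proof.
move=> g01; rewrite horner1_density_poly mulr_sumr.
by apply: eq_bigr => S /eqP Sm; rewrite weightE.
Qed.

Lemma density_poly_gt0 g : (m <= #|V|)%N -> 0 < g < 1 -> 0 < (density_poly G m g).[1].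
Proof.
move=> mV /andP[g0 g1]; rewrite horner1_density_poly.
have pos S : #|S| = m -> 0 < clique_prod (fun e => 1 + edge_sign G g e) S.
  by move=> Sm; rewrite clique_prod_sign // mulr_gt0 // exprn_gt0 ?subr_gt0 ?addr_gt0.
have : (0 < #|[set S : {set V} | #|S| == m]|)%N.
  by rewrite card_draws bin_gt0.
rewrite card_gt0 => /set0Pn[S]; rewrite inE => Sm.
rewrite (bigD1 S) //= ltr_wpDr ?pos //; last exact/eqP.
by apply: sumr_ge0 => T /andP[/eqP Tm _]; rewrite ltW // pos.
Qed.

Lemma size_density_poly g : (size (density_poly G m g) <= N.+1)%N.
Proof.
apply: leq_trans (size_sum _ _ _) _; apply/bigmax_leqP => S /andP[/eqP Sm _].
apply: leq_trans (size_poly_prod_leq _ _) _.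
rewrite leq_subLR addnS ltnS.
have -> : #|[pred e : {set V} | (#|e| == 2) && (e \subset S)]| = N.
  by rewrite -(card_pairs_in Sm) cardsE; apply: eq_card => e; rewrite !inE andbC.
rewrite addnn -mul2n -(card_pairs_in Sm) mulnC cardsE.
rewrite (eq_card (B := [pred e : {set V} | (#|e| == 2) && (e \subset S)])); last first.
  by move=> e; rewrite !inE andbC.
rewrite -sum_nat_const; apply: leq_sum => e _.
apply: leq_trans (size_polyD _ _) _; rewrite geq_max size_polyC oner_eq0 /=.
by rewrite (leq_trans (size_scale_leq _ _)) // size_polyX.
Qed.

End Weights.

(** * Weights as exponentials of the density *)

(** The even powers cancel in ln (1 - g) - ln (1 + g), and [log_factor] with two
    terms controls the rest. *)
Lemma ln_ratio (R : realType) (g : R) : 0 < g <= 1 / 2 ->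
  `| ln (1 - g) - ln (1 + g) + 2 * g | <= 4 * g ^+ 3.
Proof.
move=> /andP[g0 g2]; have g1 : 0 < g < 1 by lra.
have Eg (x : R) : 0 < 1 - x -> cabs (1 - x%:C%C) = 1 - x.
  by move=> x1; rewrite -(rmorph1 (real_complex R)) -rmorphB cabs_real gtr0_norm.
have RX (x : R) k : Re (x%:C%C ^+ k) = x ^+ k by rewrite -rmorphXn.
have h1 := log_factor (q := g%:C%C) (rho := g) 2 _ g1.
have h2 := log_factor (q := (- g)%:C%C) (rho := g) 2 _ g1.
rewrite !cabs_real normrN gtr0_norm // lexx in h1 h2.
have {h1} := h1 isT; have {h2} := h2 isT.
rewrite !Eg ?opprK; [|lra|lra].
rewrite !big_ord_recr !big_ord0 !RX /= !add0r !expr1.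
have c0 : g ^+ 3 / (1 - g) <= 2 * g ^+ 3.
  rewrite ler_pdivrMr ?subr_gt0; last by lra.
  have : 0 <= g ^+ 3 by rewrite exprn_ge0 // ltW.
  nra.
rewrite !ler_norml sqrrN => /andP[a1 a2] /andP[b1 b2].
by apply/andP; split; lra.
Qed.

Section Estimate.
Variables (R : realType) (gamma : R) (dom : nat -> nat -> bool).
Hypotheses (gamma0 : 0 < gamma) (gamma2 : gamma <= 1 / 2).

Lemma step_bounds m : (1 < m)%N -> 0 < gamma / (m%:R - 1) <= 1 / 2.
Proof.
move=> m1; have m0 : 1 <= m%:R - 1 :> R.
  have : 2 <= m%:R :> R by rewrite (ler_nat _ 2 m).
  lra.
have m00 : 0 < m%:R - 1 :> R by lra.
rewrite divr_gt0 //= ler_pdivrMr //.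
move: gamma2 m0; set x := m%:R - 1 => h1 h2. lra.
Qed.

Lemma bin2_R m : (1 < m)%N -> 'C(m, 2)%:R * 2 = m%:R * (m%:R - 1) :> R.
Proof.
move=> m1; have -> : m%:R - 1 = m.-1%:R :> R by rewrite -subn1 natrB // ltnW.
rewrite -natrM muln2 bin2.
have -> : (m * m.-1)./2.*2 = (m * m.-1)%N.
  have ev : odd (m * m.-1) = false.
    by rewrite oddM; case: (m) => //= k; rewrite andNb.
  by rewrite -[RHS]odd_double_half ev add0n.
by rewrite natrM.
Qed.

(** The exponent differs from [gamma * m * density] by (1 - density) times
    'C(m, 2) (ln (1 - g) - ln (1 + g) + 2 g), which has order m^2 g^3, i.e.
    order 1 / m. *)
Theorem weight_estimate_ok : weight_estimate gamma dom (8 * gamma ^+ 3).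
Proof.
move=> V G m S /andP[m1 mV] _ Sm; pose g := gamma / (m%:R - 1).
have gb := step_bounds m1; rewrite -/g in gb; have /andP[g0 g2] := gb.
pose t := density R G S; pose N := 'C(m, 2).
have N0 : 0 < (N%:R : R) by rewrite ltr0n bin_gt0.
have tE : t = #|edges_in G S|%:R / N%:R by rewrite /t /density Sm.
have t0 : 0 <= t by rewrite tE divr_ge0.
have t1 : t <= 1 by rewrite tE ler_pdivrMr // mul1r ler_nat card_edges_in.
have m00 : m%:R - 1 != 0 :> R by rewrite subr_eq0 (eqr_nat _ m 1) gtn_eqF.
have gm : gamma * m%:R = N%:R * 2 * g by rewrite bin2_R // /g; field.
exists ((1 - t) * (N%:R * (ln (1 - g) - ln (1 + g) + 2 * g))).
  have L := ln_ratio gb.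
  rewrite !normrM (ger0_norm (ltW N0)) ger0_norm ?subr_ge0 //.
  apply: le_trans (_ : 1 * (N%:R * (4 * g ^+ 3)) <= _).
    apply: ler_pM; rewrite ?subr_ge0 ?mulr_ge0 ?(ltW N0) //; first lra.
    by rewrite ler_pM2l.
  have -> : 1 * (N%:R * (4 * g ^+ 3)) = gamma * m%:R * (2 * g ^+ 2) by rewrite gm; ring.
  have m2 : 2 <= m%:R :> R by rewrite (ler_nat _ 2 m).
  have m0 : 0 < m%:R :> R by lra.
  have -> : gamma * m%:R * (2 * g ^+ 2)
     = 8 * gamma ^+ 3 / m%:R * (m%:R ^+ 2 / (4 * (m%:R - 1) ^+ 2)).
    by rewrite /g; field; rewrite m00 gt_eqF.
  rewrite ler_piMr ?divr_ge0 ?mulr_ge0 ?exprn_ge0 ?(ltW gamma0) ?(ltW m0) //.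
  have m1p : 0 < m%:R - 1 :> R by lra.
  rewrite ler_pdivrMr ?mul1r ?mulr_gt0 ?exprn_gt0 //.
  by move: (m%:R) m2 => x x2; nra.
rewrite /weight -/g -/t /powR.
have p1 : 1 + g != 0 by rewrite gt_eqF // addr_gt0.
have p2 : 1 - g != 0 by rewrite gt_eqF // subr_gt0; lra.
rewrite (negPf p1) (negPf p2) -!expRD; congr expR.
rewrite gm -/N; ring.
Qed.

End Estimate.

(** * Running time *)

Section Budget.
Local Open Scope nat_scope.

(** Stated for all [j] at once, because a new edge set of size at most [j.+1]
    comes from an old one of size at most [j]. *)
Lemma count_edge_sets K ps j : j <= K ->
  count (fun J => size J <= j) (edge_sets K ps) <= (size ps).+1 ^ j.
Proof.
elim/last_ind: ps j => [|ps p IH] j jK; first by rewrite /= exp1n.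
rewrite -cats1 edge_sets_cat /= /add_edge count_cat count_map count_filter.
rewrite size_cat /= addn1.
case: j jK => [|j] jK.
  have -> : count (predI (preim (cons p) (fun J => size J <= 0)) (fun J => size J < K))
    (edge_sets K ps) = 0 by apply/eqP; rewrite -leqn0 leqNgt -has_count; apply/hasPn.
  by rewrite addn0 IH.
have h1 := IH j.+1 jK; have h2 := IH j (ltnW jK).
apply: (@leq_trans ((size ps).+1 ^ j.+1 + (size ps).+1 ^ j)).
  apply: leq_add => //; apply: leq_trans h2.
  by apply: sub_count => J /= /andP[].
have mono : (size ps).+1 ^ j <= (size ps).+2 ^ j.
  by case: (j) => [|i]; rewrite ?expn0 ?leq_exp2r.
by rewrite [X in _ <= X]expnS mulSn addnC leq_add // expnS leq_mul.
Qed.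

Lemma size_mem_edge_sets K ps J : J \in edge_sets K ps -> size J <= K.
Proof.
elim/last_ind: ps J => [|ps p IH] J; first by rewrite inE => /eqP ->.
rewrite -cats1 edge_sets_cat /= /add_edge mem_cat => /orP[/IH //|/mapP[J']].
by rewrite mem_filter => /andP[J'K _] ->.
Qed.

Lemma size_edge_sets K ps : size (edge_sets K ps) <= (size ps).+1 ^ K.
Proof.
apply: leq_trans (count_edge_sets ps (leqnn K)); rewrite leq_eqVlt; apply/orP; left; apply/eqP.
by apply/esym/eqP; rewrite -all_count; apply/allP => J /size_mem_edge_sets.
Qed.

Lemma size_pairs n : 0 < n -> (size (pairs n)).+1 <= n ^ 2.
Proof.
case: n => // n _; rewrite /pairs; elim: n => [|n IH] //.
rewrite iota_rcons map_rcons flatten_rcons size_cat size_map size_iota.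
by move: IH; set x := size _; rewrite !expnS expn0; nia.
Qed.

(** A bound for all loop counts of the program, and for the constants. *)
Definition budget n m :=
  1000 + n + taylor_order m + exp_steps m (taylor_order m) + size (edge_sets (taylor_order m) (pairs n)).

(** Each summand is at most [n ^ (323 * up_log 2 m)], the largest exponent
    coming from [exp_steps]; there are five summands, and 5 < 2 ^ 3 <= n ^ 3. *)
Lemma budget_le n m : 1 < m <= n -> budget n m <= n ^ (326 * up_log 2 m).
Proof.
move=> /andP[m1 mn]; have n1 : 1 < n := leq_trans m1 mn.
have n0 : 0 < n := ltnW n1.
set L := up_log 2 m; have L0 : 0 < L by rewrite up_log_gt0.
have le_exp a b : a <= b -> n ^ a <= n ^ b by move=> ab; rewrite leq_pexp2l.
have two_exp a : 2 ^ a <= n ^ a by case: a => // a; rewrite leq_exp2r.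
have b1 : 1000 <= n ^ (323 * L).
  apply: (@leq_trans (2 ^ 10)) => //; apply: leq_trans (two_exp 10) _.
  by apply: le_exp; lia.
have b2 : n <= n ^ (323 * L) by rewrite -{1}[n]expn1; apply: le_exp; lia.
have bK : (taylor_order m).+1 <= n ^ (156 * L).
  by apply: leq_trans (two_exp _); rewrite ltn_expl.
have b3 : taylor_order m <= n ^ (323 * L).
  by apply: leq_trans (ltnW bK) _; apply: le_exp; lia.
have b4 : exp_steps m (taylor_order m) <= n ^ (323 * L).
  have q : m * m * (taylor_order m).+1 <= n ^ (2 + 156 * L).
    by rewrite expnD leq_mul // -mulnn leq_mul.
  apply: (@leq_trans (n ^ 7 * n ^ (2 + 156 * L) * n ^ (2 + 156 * L))).
    rewrite /exp_steps; apply: leq_mul => //; apply: leq_mul => //.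
    by apply: leq_trans (two_exp 7).
  by rewrite -!expnD; apply: le_exp; lia.
have b5 : size (edge_sets (taylor_order m) (pairs n)) <= n ^ (323 * L).
  apply: leq_trans (size_edge_sets _ _) _.
  apply: (@leq_trans ((n ^ 2) ^ taylor_order m)).
    by rewrite leq_exp2r ?size_pairs // /taylor_order muln_gt0.
  by rewrite -expnM; apply: le_exp; rewrite /taylor_order -/L; lia.
apply: (@leq_trans (2 ^ 3 * n ^ (323 * L))).
  by rewrite /budget; lia.
apply: (@leq_trans (n ^ 3 * n ^ (323 * L))).
  by rewrite leq_mul // two_exp.
by rewrite -expnD; apply: le_exp; lia.
Qed.

End Budget.

Section Cost.
Variable R : realType.

(** From 2^(L - 1) < m, where L is the binary logarithm rounded up, and
    2 m <= m^2. *)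
Lemma up_log_le_ln m : (1 < m)%N -> (up_log 2 m)%:R * ln 2 <= 2 * ln m%:R :> R.
Proof.
move=> m1; rewrite !mulr_natl -!lnXn ?ltr0n ?(ltnW m1) //.
rewrite ler_ln ?posrE ?exprn_gt0 ?ltr0n ?(ltnW m1) // -!natrX ler_nat.
case E : (up_log 2 m) => [|L]; first by rewrite expn0 expn_gt0 ltnW.
have lt : (2 ^ L < m)%N.
  by rewrite ltnNge; apply/negP => /(@up_log_min 2 _ _ isT); rewrite E ltnn.
by rewrite expnS expnS expn1 leq_mul // ltnW.
Qed.

Lemma budget_cost (D n m t : nat) : (1 < m <= n)%N -> (t <= budget n m ^ D)%N ->
  t%:R <= n%:R `^ ((326 * D)%:R * (2 / ln 2) * ln m%:R) :> R.
Proof.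
move=> mn tD; have /andP[m1 mn'] := mn.
have ln2 : 0 < ln 2 :> R by rewrite ln_gt0 // ltr1n.
apply: (@le_trans _ _ (n%:R `^ (326 * up_log 2 m * D)%:R)).
  rewrite powR_mulrn // -natrX ler_nat; apply: leq_trans tD _.
  by rewrite expnM; case: (D) => // d; rewrite leq_exp2r // budget_le.
apply: ler_powR; first by rewrite ler1n (leq_trans _ mn') // ltnW.
have -> : (326 * up_log 2 m * D)%N = (326 * D * up_log 2 m)%N by rewrite mulnAC.
rewrite natrM -mulrA; apply: ler_wpM2l; first exact: ler0n.
by rewrite mulrAC ler_pdivlMr // up_log_le_ln.
Qed.

End Cost.

(** * Accuracy of the output *)

Section Error.
Variable R : realType.

(** The lower bound uses 1 + y >= exp (y / (1 + y)) and
    y / (1 + y) >= y - 2 y^2, so that M factors lose at most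
    2 Y^2 / M <= 1 / 50 in the exponent. *)
Lemma exp_power_bounds (Y B : R) : 1 <= B -> `|Y| <= B -> forall M : nat,
  M%:R = 100 * B * B ->
  expR (Y - 1 / 50) <= (1 + Y / M%:R) ^+ M <= expR Y.
Proof.
move=> B1 YB M ME.
have M0 : 0 < M%:R :> R by rewrite ME; nra.
pose y := Y / M%:R; have Yy : Y = M%:R * y by rewrite mulrC divfK // gt_eqF.
have y2 : `|y| <= 1 / 2.
  rewrite /y normrM normfV (gtr0_norm M0) ler_pdivrMr // ME.
  by apply: le_trans YB _; nra.
have {y2} /andP[y_ge y_le] : - (1 / 2) <= y <= 1 / 2 by rewrite -ler_norml.
have yp : 0 < 1 + y by lra.
apply/andP; split; last first.
  rewrite -/y Yy expRM_natl lerXn2r ?nnegrE ?expR_ge0 ?(ltW yp) //.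
  exact: expR_ge1Dx.
have low : expR (y - 2 * y ^+ 2) <= 1 + y.
  have h1 : (1 + y)^-1 <= expR (- (y / (1 + y))).
    have := expR_ge1Dx (- (y / (1 + y))); congr (_ <= _).
    by field; rewrite gt_eqF.
  have h2 : expR (y / (1 + y)) <= 1 + y.
    by move: h1; rewrite expRN lef_pV2 ?posrE ?expR_gt0.
  apply: le_trans h2; rewrite ler_expR ler_pdivlMr //; nra.
apply: (@le_trans _ _ (expR (y - 2 * y ^+ 2) ^+ M)); last first.
  by rewrite lerXn2r ?nnegrE ?expR_ge0 ?(ltW yp).
rewrite -expRM_natl ler_expR mulrBr -Yy lerB //.
have -> : M%:R * (2 * y ^+ 2) = 2 * Y ^+ 2 / M%:R by rewrite /y; field; rewrite gt_eqF.
rewrite ler_pdivrMr // ME; move: YB; rewrite ler_norml => /andP[? ?]; nra.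
Qed.

(** The exponents differ by at most 1 / 25, which keeps the ratio between
    24 / 25 and 50 / 49. *)
Lemma relative_error (A D q T X c : R) : 0 < A -> D = A * expR (c + X) ->
  expR (T + c - 1 / 50) <= q <= expR (T + c) -> `|X - T| <= 1 / 50 ->
  `| A * q - D | <= 1 / 10 * D.
Proof.
move=> A0 -> /andP[q1 q2]; rewrite ler_norml => /andP[h1 h2].
have -> : A * q - A * expR (c + X) = A * (q - expR (c + X)) by ring.
rewrite normrM (gtr0_norm A0) mulrCA ler_pM2l //.
set e := expR (c + X); have e0 : 0 < e := expR_gt0 _.
have up : q <= e * (50 / 49).
  apply: le_trans q2 _; apply: (@le_trans _ _ (e * expR (1 / 50))).
    by rewrite -expRD ler_expR; lra.
  rewrite ler_pM2l //.
  have := expR_ge1Dx (- (1 / 50) : R); rewrite expRN => h.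
  have : (50 / 49 : R)^-1 <= (expR (1 / 50))^-1 by lra.
  by rewrite lef_pV2 ?posrE ?expR_gt0 //; lra.
have low : e * (24 / 25) <= q.
  apply: le_trans q1; apply: (@le_trans _ _ (e * expR (- (1 / 25)))).
    rewrite ler_pM2l //; have := expR_ge1Dx (- (1 / 25) : R); lra.
  by rewrite -expRD ler_expR; lra.
rewrite ler_norml; apply/andP; split; lra.
Qed.

(** With L = up_log 2 m the left side is at most 19 4^L 2^(- 12 L). *)
Lemma tail_bound m : (1 < m)%N ->
  'C(m, 2)%:R * ((18 / 19) ^+ (taylor_order m).+1 / (1 - 18 / 19)) <= 1 / 50 :> R.
Proof.
move=> m1; set L := up_log 2 m.
have L0 : (0 < L)%N by rewrite up_log_gt0.
have half : (18 / 19 : R) ^+ 13 <= 1 / 2 by lra.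
have powL : (18 / 19 : R) ^+ (taylor_order m).+1 <= (1 / 2) ^+ (12 * L).
  rewrite exprS /taylor_order -/L; have -> : (156 * L = 13 * (12 * L))%N by lia.
  rewrite exprM; set x := _ ^+ 13 in half *.
  have x0 : 0 <= x by rewrite exprn_ge0 //; lra.
  apply: (@le_trans _ _ (1 * x ^+ (12 * L))).
    by rewrite ler_wpM2r ?exprn_ge0 //; lra.
  by rewrite mul1r lerXn2r ?nnegrE.
have N4 : 'C(m, 2)%:R <= 4 ^+ L :> R.
  rewrite -natrX ler_nat; apply: (@leq_trans (m ^ 2)).
    by rewrite bin2 -divn2 (leq_trans (leq_div _ _)) // expnS expn1 leq_mul // leq_pred.
  rewrite -[4%N]/(2 ^ 2)%N -expnM mulnC expnM leq_exp2r //; exact: up_logP.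
have h18 : 1 - 18 / 19 = 19^-1 :> R by lra.
rewrite h18 invrK.
apply: (@le_trans _ _ (4 ^+ L * ((1 / 2) ^+ (12 * L) * 19))).
  have pos : 0 <= (18 / 19 : R) ^+ (taylor_order m).+1 by rewrite exprn_ge0 //; lra.
  apply: ler_pM => //.
  by rewrite ler_wpM2r.
have -> : 4 ^+ L * ((1 / 2) ^+ (12 * L) * 19) = 19 * (1 / 1024 : R) ^+ L.
  rewrite exprM mulrA -exprMn.
  by rewrite [RHS]mulrC; congr (_ ^+ _ * _); lra.
have : (1 / 1024 : R) ^+ L <= (1 / 1024) ^+ 1.
  by apply: ler_wiXn2l; [clear; lra|clear; lra|exact: L0].
rewrite expr1; move: (_ ^+ L) => x hx; clear -hx; lra.
Qed.

End Error.

Lemma ratr_edge_term (R : realType) n m adj (g : rat) J :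
  ratr (edge_term n m adj g J) = edge_term n m adj (ratr g : R) J.
Proof.
rewrite /edge_term /contain_prob /sgn_adj rmorphM !rmorph_prod; congr (_ * _).
  by apply: eq_bigr => e _; rewrite rmorphM rmorphB rmorphM !rmorph_nat rmorph1.
by apply: eq_bigr => i _; rewrite fmorph_div !rmorphB !rmorph_nat.
Qed.

Lemma ratr_out_value (R : realType) n m (gq Y : rat) (g : R) :
  (m <= n)%N -> g = ratr gq / (m%:R - 1) ->
  ratr (out_value n m gq Y)
  = (1 + (ratr Y + ratr gq * m%:R) / (exp_steps m (taylor_order m))%:R)
      ^+ exp_steps m (taylor_order m)
    * 'C(n, m)%:R * (1 + g)^-1 ^+ 'C(m, 2) :> R.
Proof.
move=> mn gE; rewrite /out_value bin_prod //.
move: (exp_steps _ _) 'C(n, m) 'C(m, 2) => M b N; rewrite !rmorphM !rmorphXn fmorphV /=.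
rewrite !rmorphD !fmorph_div rmorphD rmorphM rmorphB !rmorph_nat !rmorph1.
by rewrite -gE.
Qed.

Section Algorithm.
Variables (R : realType) (gq : rat) (dom : nat -> nat -> bool).
Hypotheses (gq_gt0 : 0 < gq) (gq_le : gq <= 1 / 2).
Local Notation gamma := (ratr gq : R).
Hypothesis free : zero_free (gamma * (19 / 18)) dom.

Lemma input_start (V : finType) (G : sgraph V) (m : nat) (x0 : V) :
  start #|V| m (adjacent G x0) (input G m).
Proof.
split=> //; last by case=> [|[|y]].
move=> u v /andP[vu un] /=; congr (nat_of_bool _)%:R.
have vn := ltn_trans vu un.
apply/existsP/idP => [[x /existsP[y /andP[/eqP E xy]]]|uv].
  have {}E : u = enum_rank x /\ v = enum_rank y :> nat.
    have E1 := congr1 (fun k => k %/ #|V|)%N E; have E2 := congr1 (fun k => k %% #|V|)%N E.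
    have V0 : (0 < #|V|)%N := leq_ltn_trans (leq0n _) un.
    rewrite /= !divnMDl // !(divn_small vn) divn_small // !addn0 in E1.
    by rewrite /= !modnMDl !modn_small in E2.
  by case: E => -> ->; rewrite /adjacent !rankK.
exists (vertex x0 u); apply/existsP; exists (vertex x0 v).
by rewrite !vertexK // eqxx.
Qed.

(** At [z] the weight of every pair is within [cabs z * g] of 1, and the
    factor 19 / 18 in the radius of the polydisc is spent on [cabs z]. *)
Lemma density_poly_neq0 (V : finType) (G : sgraph V) (m : nat) (z : R[i]) :
  (1 < m <= #|V|)%N -> dom #|V| m -> cabs z <= (18 / 19)^-1 ->
  (map_poly (real_complex R) (density_poly G m (gamma / (m%:R - 1)))).[z] != 0.
Proof.
move=> mV dm z1; have /andP[m1 _] := mV.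
pose g := gamma / (m%:R - 1).
have g0 : 0 < g by rewrite divr_gt0 ?ltr0q // subr_gt0 (ltr_nat _ 1 m).
suff -> : (map_poly (real_complex R) (density_poly G m g)).[z]
   = clique_sum m (fun e => 1 + z * (edge_sign G g e)%:C%C) finset.set0.
  apply: (free mV dm) => e _.
  rewrite addrC addKr cabsM cabs_real.
  have -> : `|edge_sign G g e| = g.
    rewrite /edge_sign normrM gtr0_norm //; case: (_ \in _) => /=.
      by rewrite mulr1 (_ : 2 - 1 = 1 :> R) ?normr1 ?mulr1 //; lra.
    by rewrite mulr0 sub0r normrN1 mulr1.
  rewrite mulrAC -/g mulrC ler_wpM2l ?(ltW g0) //.
  by apply: le_trans z1 _; lra.
rewrite -horner_segment_poly; congr (_.[z]).
rewrite /density_poly /segment_poly /clique_sum rmorph_sum; apply: eq_bigr => S _.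
rewrite /clique_prod rmorph_prod; apply: eq_bigr => e _.
by rewrite rmorphD /= map_polyC map_polyZ map_polyX rmorph1.
Qed.

Lemma density_poly0 (V : finType) (G : sgraph V) (m : nat) (g : R) :
  (density_poly G m g)`_0 = 'C(#|V|, m)%:R.
Proof.
rewrite -horner_coef0 horner_segment_poly /clique_sum.
rewrite (eq_bigr (fun=> 1)); last first.
  by move=> S _; rewrite /clique_prod big1 // => e _; rewrite mul0r addr0.
rewrite sumr_const -card_draws cardsE; congr (_ *+ _); apply: eq_card => S.
by rewrite unfold_in /= finset.sub0set andbT.
Qed.

Theorem density_algorithm_ok :
  density_algorithm gamma dom (density_prog gq)
    ((326 * depth (density_prog gq))%:R * (2 / ln 2)).
Proof.
move=> V G m mV dm; have /andP[m1 mn] := mV.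
have /card_gt0P[x0 _] : (0 < #|V|)%N := leq_trans (ltnW m1) mn.
pose K := taylor_order m; pose M := exp_steps m K; pose N := 'C(m, 2).
pose Z := budget #|V| m.
pose adj := adjacent G x0; pose g := gamma / (m%:R - 1).
pose c k := \sum_(J <- edge_sets K (pairs #|V|) | size J == k)
  edge_term #|V| m adj (gq / (m%:R - 1)) J.
have [t [s [ex tZ [l [hl out]]]]] : runs Z (input G m) (density_prog gq) (fun s' =>
    exists l, log_coefs c l K
      /\ s' aOUT 0 = out_value #|V| m gq (\sum_(k < K) l k.+1)).
  by apply: density_prog_ok => //; try (rewrite /Z /budget -/K; lia); exact: input_start.
exists t, s; split=> //.
  exact: budget_cost.
have gam0 : 0 < gamma by rewrite ltr0q.
have gam2 : gamma <= 1 / 2.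
  by have := gq_le; rewrite -(ler_rat R) fmorph_div rmorph1 rmorph_nat.
have gb : 0 < g <= 1 / 2 := step_bounds gam0 gam2 m1.
have g01 : 0 < g < 1 by case/andP: gb => g0 g2; apply/andP; split => //; lra.
pose P := density_poly G m g; pose lR k : R := ratr (l k).
have P0 : P`_0 = 'C(#|V|, m)%:R := density_poly0 G m g.
have C0 : 0 < 'C(#|V|, m)%:R :> R by rewrite ltr0n bin_gt0.
have P0_gt0 : 0 < P`_0 by rewrite P0.
have P1_gt0 : 0 < P.[1] := density_poly_gt0 G mn g01.
have Pk k : (k <= K)%N -> P`_k = 'C(#|V|, m)%:R * ratr (c k).
  move=> kK; rewrite (coef_density_poly G x0 mn g kK) rmorph_sum; congr (_ * _).
  apply: eq_bigr => J _; rewrite /= ratr_edge_term; congr (edge_term _ _ _ _ _).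
  by rewrite fmorph_div rmorphB rmorph1 rmorph_nat.
clearbody c.
have lP k : (0 < k <= K)%N ->
    k%:R * P`_k = \sum_(1 <= i < k.+1) i%:R * lR i * P`_(k - i).
  case: k => // k /= kK; rewrite big_add1 /= big_mkord big_ord_recr /= subnn P0.
  have := congr1 (fun x : rat => (ratr x : R)) (hl k kK).
  rewrite rmorphB fmorph_div rmorph_nat rmorph_sum /= => /eqP.
  rewrite -/(lR _) eq_sym subr_eq => /eqP E.
  rewrite Pk // E mulrDr mulrDr addrC; congr (_ + _); first by rewrite /lR; ring.
  rewrite mulrCA [k.+1%:R * _]mulrC divfK ?pnatr_eq0 // mulr_sumr.
  apply: eq_bigr => j _; rewrite subSS Pk ?(leq_trans (leq_subr _ _)) ?(ltnW kK) //.
  by rewrite !rmorphM rmorph_nat /lR; ring.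
have rho01 : 0 < (18 / 19 : R) < 1 by apply/andP; split; lra.
have [tail size_T] := log_taylor rho01 P0_gt0 P1_gt0
  (size_density_poly G m g) (fun z => density_poly_neq0 G mV dm) lP.
pose T := \sum_(k < K) lR k.+1.
pose B : R := (m * m * K.+1)%N%:R.
have m_ge2 : 2 <= m%:R :> R by rewrite (ler_nat _ 2 m).
have B1 : 1 <= B by rewrite ler1n !muln_gt0 /= !(ltnW m1).
have TB : `|T + gamma * m%:R| <= B.
  have -> : B = m%:R * m%:R * K%:R + m%:R * m%:R.
    by rewrite /B natrM natrM -[K.+1%:R]natr1; ring.
  apply: le_trans (ler_normD _ _) _; apply: lerD.
    apply: le_trans size_T _; rewrite ler_wpM2r // -natrM ler_nat.
    by rewrite /N bin2 -divn2 (leq_trans (leq_div _ _)) // leq_mul // leq_pred.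
  have m0 : 0 < m%:R :> R by rewrite ltr0n ltnW.
  rewrite gtr0_norm; last exact: mulr_gt0.
  by rewrite ler_wpM2r //; apply: le_trans gam2 (le_trans _ m_ge2); lra.
have ME : M%:R = 100 * B * B :> R by rewrite /M /exp_steps natrM [(100 * _)%:R]natrM.
have qb := exp_power_bounds B1 TB ME.
have TY : T = ratr (\sum_(k < K) l k.+1) by rewrite rmorph_sum.
rewrite /output out (ratr_out_value _ mn (erefl g)) -TY -/K -/M.
pose A : R := 'C(#|V|, m)%:R * (1 + g)^-1 ^+ N.
have A0 : 0 < A.
  by rewrite mulr_gt0 // exprn_gt0 // invr_gt0 addr_gt0 //; case/andP: g01.
have DE : Density G gamma m = A * expR (gamma * m%:R + ln (P.[1] / P`_0)).
  rewrite (DensityE G m1 g01) expRD lnK ?posrE ?divr_gt0 // P0 /A.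
  by rewrite -/g -/P -/N; field; rewrite gt_eqF.
rewrite -mulrA mulrC.
apply: (relative_error A0 DE qb).
apply: le_trans tail _; exact: tail_bound.
Qed.

End Algorithm.

(** The parameter is rational because it is a constant of the program. *)
Lemma density_claim_rat (R : realType) (gq : rat) (gamma : R) (dom : nat -> nat -> bool) :
  0 < gq <= 1 / 2 -> ratr gq = gamma -> zero_free (gamma * (19 / 18)) dom ->
  density_claim gamma dom.
Proof.
move=> /andP[g0 g2] <- free; split.
  by eexists; eexists; exact: density_algorithm_ok free.
eexists; apply: weight_estimate_ok; first by rewrite ltr0q.
by move: g2; rewrite -(ler_rat R) fmorph_div rmorph1 rmorph_nat.
Qed.

Unset Implicit Arguments.
Set Strict Implicit.
Set Printing Implicit Defensive.

Theorem mainTheorem3 (R : realType) :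
  (exists2 gamma : R, 0 < gamma & density_claim gamma (fun n m => true))
  /\ density_claim (6 / 100 : R) (fun n m => true)
  /\ density_claim (18 / 100 : R) (fun n m => (4 * m <= n) && (10 <= m))%N.
Proof.
have claim6 : density_claim (6 / 100 : R) (fun n m => true).
  apply: (@density_claim_rat R (6 / 100)) => //.
    by rewrite fmorph_div !rmorph_nat.
  have -> : 6 / 100 * (19 / 18) = 19 / 300 :> R by lra.
  exact: zero_free_all.
split; first by exists (6 / 100) => //; lra.
split=> //; apply: (@density_claim_rat R (18 / 100)) => //.
  by rewrite fmorph_div !rmorph_nat.
have -> : 18 / 100 * (19 / 18) = 19 / 100 :> R by lra.
exact: zero_free_sparse.
Qed.
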